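(* Let $\mathcal{F}$ be a family of $n$ non-overlapping unit balls in $\mathbb{R}^d$. The number of geometric permutations of $\mathcal{F}$ is at most three if $n \le 6$, and at most two if $n \ge 7$.
   Context: A unit ball is a closed ball of radius one. A family of compact convex sets in $\mathbb{R}^d$ is non-overlapping if its members have pairwise disjoint interiors (they may touch). A line transversal to a non-overlapping family is a line that intersects every member of the family and that is not tangent to two touching members at their common point of contact (equivalently, common points of contact are removed from the sets, which makes them pairwise disjoint). An oriented line transversal induces a linear order on the family, namely the order in which it meets the members (for unit balls, $X$ comes before $Y$ if and only if $\vec{v}\cdot (y-x) > 0$, where $\vec{v}$ is the direction of the line and $x,y$ are the centers). A geometric permutation of the family is a pair consisting of an order induced by some line transversal and its reverse; an order and its reverse are counted as one geometric permutation. *)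

(* Defs.v *)
From HB Require Import structures.
From mathcomp Require Import all_boot all_order all_algebra all_fingroup.
From mathcomp Require Import boolp classical_sets reals topology normedtype.

Set Implicit Arguments.
Unset Strict Implicit.
Unset Printing Implicit Defensive.

Import Order.TTheory GRing.Theory Num.Theory.
Import numFieldNormedType.Exports.

Local Open Scope classical_set_scope.
Local Open Scope ring_scope.

(* The library norm on 'rV[R]_d is the sup norm, so the Euclidean norm is
   defined here.  The library topology on 'rV[R]_d is the usual one of R^d. *)
Definition enorm (R : realType) (d : nat) (x : 'rV[R]_d) : R :=
  Num.sqrt (\sum_(i < d) x 0 i ^+ 2).

Definition unit_ball (R : realType) (d : nat) (c : 'rV[R]_d) : set 'rV[R]_d :=
  [set x | enorm (x - c) <= 1].

Definition non_overlapping (R : realType) (d n : nat)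
    (F : 'I_n -> set 'rV[R]_d) : Prop :=
  forall i j, i != j -> (F i)° `&` (F j)° = set0.

Definition line (R : realType) (d : nat) (p v : 'rV[R]_d) : set 'rV[R]_d :=
  range (fun t : R => p + t *: v).

Definition tangent_at (R : realType) (d : nat) (L X : set 'rV[R]_d)
    (q : 'rV[R]_d) : Prop :=
  [/\ L q, X q & L `&` X° = set0].

(* In a non-overlapping family, a point common to two members is a point of
   contact: the last clause forbids tangency to both members there. *)
Definition line_transversal (R : realType) (d n : nat)
    (F : 'I_n -> set 'rV[R]_d) (p v : 'rV[R]_d) : Prop :=
  [/\ v != 0,
      forall i, line p v `&` F i !=set0 &
      forall i j q, i != j ->
        ~ (tangent_at (line p v) (F i) q /\ tangent_at (line p v) (F j) q)].

(* The comparison is large because the line may pass from X to Y through their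
   point of contact.  It still separates the members met by a transversal: if
   both X before Y and Y before X, then the line meets X and Y in one and the
   same point, at which it is tangent to both. *)
Definition meets_before (R : realType) (d : nat) (p v : 'rV[R]_d)
    (X Y : set 'rV[R]_d) : Prop :=
  forall s t : R, X (p + s *: v) -> Y (p + t *: v) -> s <= t.

(* An order on the family is encoded by the permutation s such that s k is the
   index of the k-th member. *)
Definition induced_order (R : realType) (d n : nat)
    (F : 'I_n -> set 'rV[R]_d) (s : 'S_n) : Prop :=
  exists p v : 'rV[R]_d, line_transversal F p v /\
    forall i j : 'I_n, (i < j)%N -> meets_before p v (F (s i)) (F (s j)).

(* (s * t) x = t (s x), so reverse_order s maps k to s (rev_ord k). *)
Definition reverse_order (n : nat) (s : 'S_n) : 'S_n :=
  (perm (@rev_ord_inj n) * s)%g.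

Definition geometric_permutations (R : realType) (d n : nat)
    (F : 'I_n -> set 'rV[R]_d) : {set {set 'S_n}} :=
  [set [set s; reverse_order s] | s : 'S_n & `[< induced_order F s >]]%SET.

(* Main.v *)
Require Import Defs.
From mathcomp Require Import all_boot all_order all_algebra all_fingroup.
From mathcomp Require Import boolp classical_sets reals topology normedtype.
From mathcomp Require Import zify ring lra.

(* Along a transversal of direction v, let the heights of two centers differ by
   t and let a, b be their projections orthogonal to v, relative to the line:
   |a| <= 1, |b| <= 1 and t^2 + |a - b|^2 >= 4, hence |a + b| <= t.  Writing
   a + e = (a + b) - (b + c) + (c + e) for four consecutive projections, the
   triangle inequality shows that if a line meets A, B, C, E in this order, then
   |AE| > |AB|, |BC|, |CE|.

   These strict inequalities alone imply that three distinct geometric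
   permutations differ only inside a window of three balls x, y, z, each of
   which is the middle one in one of them, and leave no room for a fourth one.

   For n >= 7, two of the three transversals meet the window in the orders xyz
   and zxy, and all other balls in the same order before and after it.  Project
   the centers to the plane spanned by the two directions.  Both lines are at
   distance at most 1, so the projections lie in a rhombus around the crossing
   point.  The rotation of the window bounds the angle of the lines from below;
   but |a + b| <= t pushes balls met in the same order away from the tips of the
   rhombus, and three balls on one side, or two on both, do not fit in. *)

Set Implicit Arguments.
Unset Strict Implicit.
Unset Printing Implicit Defensive.
Import Order.TTheory GRing.Theory Num.Theory.
Import numFieldNormedType.Exports.
Local Open Scope ring_scope.

(** * Orders of four elements *)

(* Up to reversal, a linear order is determined by the middles of all triples. *)
Definition middle (T : Type) (lt : rel T) (x y z : T) : T :=
  if (lt x y && lt y z) || (lt z y && lt y x) then y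
  else if (lt y x && lt x z) || (lt z x && lt x y) then x else z.

Section Codes.
Local Open Scope nat_scope.

(* An order of four elements is encoded by the list of their indices; the facts
   about three orders of four elements are then checked by enumeration. *)
Definition codes : seq (seq nat) := permutations (iota 0 4).

Definition before (o : seq nat) : rel nat := fun i j => index i o < index j o.

(* The first and last elements of [o'] are consecutive in [o]: by the inequality
   for four balls, they are closer together than the first and last of [o]. *)
Definition beats (o o' : seq nat) : bool :=
  has (fun k => ((nth 0 o k == nth 0 o' 0) && (nth 0 o k.+1 == nth 0 o' 3)) ||
                ((nth 0 o k == nth 0 o' 3) && (nth 0 o k.+1 == nth 0 o' 0)))
      (iota 0 3).

(* No cyclic comparison of distances. *)
Definition consistent (o1 o2 o3 : seq nat) : bool :=
  [&& ~~ (beats o1 o2 && beats o2 o1), ~~ (beats o1 o3 && beats o3 o1),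
      ~~ (beats o2 o3 && beats o3 o2),
      ~~ [&& beats o1 o2, beats o2 o3 & beats o3 o1] &
      ~~ [&& beats o1 o3, beats o3 o2 & beats o2 o1]].

Definition rainbow_code (o1 o2 o3 : seq nat) (i j k : nat) : bool :=
  let m o := middle (before o) i j k in
  [&& m o1 != m o2, m o1 != m o3 & m o2 != m o3].

Definition odd_code (o1 o2 o3 : seq nat) (i j k : nat) : bool :=
  let m o := middle (before o) i j k in (m o1 != m o2) && (m o2 == m o3).

Definition no_rainbow_code o1 o2 o3 : bool :=
  [&& ~~ rainbow_code o1 o2 o3 0 1 2, ~~ rainbow_code o1 o2 o3 0 1 3,
      ~~ rainbow_code o1 o2 o3 0 2 3 & ~~ rainbow_code o1 o2 o3 1 2 3].

Definition check3 (P : seq nat -> seq nat -> seq nat -> bool) : bool :=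
  all (fun o1 => all (fun o2 => all (fun o3 =>
    if consistent o1 o2 o3 then P o1 o2 o3 else true) codes) codes) codes.

(** Index 0 is a fourth element joined to a triple on which [o1] is the odd one out. It can replace
    one of the three, and two triples with two common elements cannot have different odd ones out;
    [odd_spread] and [odd_share2] rest on these two facts. *)
Lemma odd_check : check3 (fun o1 o2 o3 =>
  no_rainbow_code o1 o2 o3 && odd_code o1 o2 o3 1 2 3 ==>
  (~~ odd_code o2 o1 o3 0 1 2) &&
  [|| odd_code o1 o2 o3 0 1 2, odd_code o1 o2 o3 0 1 3 | odd_code o1 o2 o3 0 2 3]).
Proof. by vm_compute. Qed.

(** A fourth element never falls inside a triple with three different middles. The statement for
    [o1] suffices, as the three orders can exchange roles. *)
Lemma rainbow_check : check3 (fun o1 o2 o3 =>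
  rainbow_code o1 o2 o3 1 2 3 ==> (index 0 o1 == 0) || (index 0 o1 == 3)).
Proof. by vm_compute. Qed.

Lemma check3P P o1 o2 o3 : check3 P -> o1 \in codes -> o2 \in codes ->
  o3 \in codes -> consistent o1 o2 o3 -> P o1 o2 o3.
Proof.
by move=> /allP H /H /allP H1 /H1 /allP H2 /H2; case: consistent.
Qed.

Lemma code_uniq o : o \in codes -> uniq o /\ size o = 4.
Proof.
rewrite mem_permutations => /[dup] /perm_uniq -> /perm_size ->.
by rewrite iota_uniq size_iota.
Qed.

Lemma code_mem o i : o \in codes -> (i \in o) = (i < 4).
Proof. by rewrite mem_permutations => /perm_mem ->; rewrite mem_iota. Qed.

End Codes.

Section Orders.
Variables (R : realDomainType) (I : eqType) (D : I -> I -> R).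
Implicit Types (h g : I -> R) (x y z w : I) (s : seq I).

Definition hlt h : rel I := fun x y => h x < h y.

(* [D] stands for the squared distance of centers and [h] for the height along a
   line transversal. *)
Definition admissible h : Prop := injective h /\
  forall x y z w, h x < h y -> h y < h z -> h z < h w ->
    [/\ D x y < D x w, D y z < D x w & D z w < D x w].

Definition codes_order x0 s h (o : seq nat) : Prop := o \in codes /\
  forall i j, (i < 4)%N -> (j < 4)%N ->
    (h (nth x0 s i) < h (nth x0 s j)) = before o i j.

Lemma code_exists x0 s h : injective h -> uniq s -> size s = 4 ->
  exists o, codes_order x0 s h o.
Proof.
move=> hI us ss.
pose le := fun i j : nat => h (nth x0 s i) <= h (nth x0 s j).
have leT : total le by move=> i j; exact: le_total.
have letr : transitive le by move=> i j k; exact: le_trans.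
have ler : reflexive le by move=> i; rewrite /le lexx.
have so := sort_sorted leT (iota 0 4).
set o := sort le (iota 0 4) in so.
have oC : o \in codes by rewrite mem_permutations; exact: permEl (perm_sort _ _).
exists o; split => // i j i4 j4; rewrite /before.
have mi : i \in o by rewrite (code_mem _ oC).
have mj : j \in o by rewrite (code_mem _ oC).
have H := sorted_leq_index letr ler so.
case: ltnP => ij.
- have := H i j mi mj (ltnW ij); rewrite /le lt_neqAle => ->; rewrite andbT.
  apply: contraTneq ij => /hI /eqP; rewrite nth_uniq ?ss //.
  by move/eqP ->; rewrite ltnn.
- by apply/negbTE; rewrite -leNgt; exact: (H j i mj mi ij).
Qed.

Lemma beats_dist x0 s h o o' : admissible h -> codes_order x0 s h o ->
    o' \in codes -> (forall x y, D x y = D y x) -> beats o o' ->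
  D (nth x0 s (nth 0 o' 0)) (nth x0 s (nth 0 o' 3)) <
  D (nth x0 s (nth 0 o 0)) (nth x0 s (nth 0 o 3)).
Proof.
move=> [hI hD] [oC ho] o'C Dsym.
have [uo so] := code_uniq oC.
have lt k : (k < 3)%N -> h (nth x0 s (nth 0 o k)) < h (nth x0 s (nth 0 o k.+1)).
  move=> k3; rewrite ho -?(code_mem _ oC) ?mem_nth ?so //; last exact: ltnW.
  by rewrite /before !index_uniq ?so // ltnW.
have [d1 d2 d3] := hD _ _ _ _ (lt 0%N isT) (lt 1%N isT) (lt 2%N isT).
by rewrite /beats /= => /or4P[| | |//] /orP[] /andP[/eqP <- /eqP <-] //; rewrite Dsym.
Qed.

Definition mid h x y z := middle (hlt h) x y z.

Definition rainbow h1 h2 h3 x y z : bool :=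
  [&& mid h1 x y z != mid h2 x y z, mid h1 x y z != mid h3 x y z &
      mid h2 x y z != mid h3 x y z].

Definition odd_triple h1 h2 h3 x y z : bool :=
  (mid h1 x y z != mid h2 x y z) && (mid h2 x y z == mid h3 x y z).

Lemma mid_code x0 s h o i j k : codes_order x0 s h o ->
  (i < 4)%N -> (j < 4)%N -> (k < 4)%N ->
  mid h (nth x0 s i) (nth x0 s j) (nth x0 s k) = nth x0 s (middle (before o) i j k).
Proof.
move=> [_ H] i4 j4 k4; rewrite /mid /middle /hlt !H //.
by case: ifP => // _; case: ifP.
Qed.

Lemma middle_lt (o : seq nat) i j k :
  (i < 4 -> j < 4 -> k < 4 -> middle (before o) i j k < 4)%N.
Proof. by rewrite /middle; case: ifP => // _; case: ifP. Qed.

Section FourPoints.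
Variables (h1 h2 h3 : I -> R) (x0 : I) (s : seq I).
Variables (o1 o2 o3 : seq nat).
Hypotheses (Dsym : forall x y, D x y = D y x).
Hypotheses (A1 : admissible h1) (A2 : admissible h2) (A3 : admissible h3).
Hypotheses (us : uniq s) (ss : size s = 4).
Hypotheses (c1 : codes_order x0 s h1 o1) (c2 : codes_order x0 s h2 o2)
  (c3 : codes_order x0 s h3 o3).

(** Each [beats] is a strict inequality between distances of end points; a cycle of these would put
    a distance below itself. *)
Lemma codes_consistent : consistent o1 o2 o3.
Proof.
have [[C1 _] [C2 _] [C3 _]] := And3 c1 c2 c3.
pose b12 := beats_dist A1 c1 C2 Dsym; pose b21 := beats_dist A2 c2 C1 Dsym.
pose b13 := beats_dist A1 c1 C3 Dsym; pose b31 := beats_dist A3 c3 C1 Dsym.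
pose b23 := beats_dist A2 c2 C3 Dsym; pose b32 := beats_dist A3 c3 C2 Dsym.
apply/and5P; split; apply/negP.
- by case/andP=> /b12 /lt_trans + /b21 => /[apply]; rewrite ltxx.
- by case/andP=> /b13 /lt_trans + /b31 => /[apply]; rewrite ltxx.
- by case/andP=> /b23 /lt_trans + /b32 => /[apply]; rewrite ltxx.
- case/and3P=> /b12 l1 /b23 l2 /b31 l3.
  by have := lt_trans l1 (lt_trans l3 l2); rewrite ltxx.
- case/and3P=> /b13 l1 /b32 l2 /b21 l3.
  by have := lt_trans l1 (lt_trans l3 l2); rewrite ltxx.
Qed.

Lemma rainbow_codeE i j k : (i < 4)%N -> (j < 4)%N -> (k < 4)%N ->
  rainbow h1 h2 h3 (nth x0 s i) (nth x0 s j) (nth x0 s k) =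
  rainbow_code o1 o2 o3 i j k.
Proof.
move=> i4 j4 k4; rewrite /rainbow (mid_code c1) // (mid_code c2) // (mid_code c3) //.
by rewrite !nth_uniq ?ss ?middle_lt.
Qed.

Lemma odd_codeE i j k : (i < 4)%N -> (j < 4)%N -> (k < 4)%N ->
  odd_triple h1 h2 h3 (nth x0 s i) (nth x0 s j) (nth x0 s k) =
  odd_code o1 o2 o3 i j k.
Proof.
move=> i4 j4 k4; rewrite /odd_triple (mid_code c1) // (mid_code c2) // (mid_code c3) //.
by rewrite !nth_uniq ?ss ?middle_lt.
Qed.

End FourPoints.

End Orders.

(** * Three orders: a triple with three different middles *)

Ltac lt_cycle := match goal with
  | a : is_true (?p < ?q), b : is_true (?q < ?r), c : is_true (?r < ?p) |- _ =>
    by move: (lt_trans a (lt_trans b c)); rewrite ltxx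
  end.

Section Combinatorics.
Variables (R : realDomainType) (I : eqType) (D : I -> I -> R).
Hypothesis Dsym : forall x y, D x y = D y x.
Implicit Types (h g : I -> R) (x y z w : I).

Notation admissible := (admissible D).

Lemma uniq12 x y z : uniq [:: x; y; z] = uniq [:: y; x; z].
Proof. by rewrite /= !inE !negb_or (eq_sym y x) !andbT andbAC. Qed.

Lemma uniq23 x y z : uniq [:: x; y; z] = uniq [:: x; z; y].
Proof.
by rewrite /= !inE !negb_or (eq_sym z y) !andbT (andbC (x != y)).
Qed.

Lemma midC12 h x y z : injective h -> uniq [:: x; y; z] -> mid h x y z = mid h y x z.
Proof.
move=> hI; rewrite /= !inE negb_or andbT => /andP[/andP[xy xz] yz].
move: xy xz yz; rewrite -!(inj_eq hI) /mid /middle /hlt.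
by case: (ltgtP (h x) (h y)) => // ?; case: (ltgtP (h y) (h z)) => // ?;
  case: (ltgtP (h x) (h z)) => // ?; lt_cycle.
Qed.

Lemma midC23 h x y z : injective h -> uniq [:: x; y; z] -> mid h x y z = mid h x z y.
Proof.
move=> hI; rewrite /= !inE negb_or andbT => /andP[/andP[xy xz] yz].
move: xy xz yz; rewrite -!(inj_eq hI) /mid /middle /hlt.
by case: (ltgtP (h x) (h y)) => // ?; case: (ltgtP (h y) (h z)) => // ?;
  case: (ltgtP (h x) (h z)) => // ?; lt_cycle.
Qed.

Lemma midN h x y z : mid (fun i => - h i) x y z = mid h x y z.
Proof.
by rewrite /mid /middle /hlt !ltrN2; case: (h x < h y); case: (h y < h x); case: (h y < h z);
  case: (h z < h y); case: (h x < h z); case: (h z < h x).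
Qed.

Lemma mid_mem h x y z : mid h x y z \in [:: x; y; z].
Proof. by rewrite /mid /middle !inE; case: ifP => _; [|case: ifP => _]; rewrite eqxx ?orbT. Qed.

Lemma admissibleN h : admissible h -> admissible (fun i => - h i).
Proof.
move=> [hI hD]; split=> [x y /oppr_inj /hI // | x y z w].
rewrite !ltrN2 => xy yz zw; have [? ? ?] := hD _ _ _ _ zw yz xy.
by rewrite (Dsym x y) (Dsym x w) (Dsym y z) (Dsym z w).
Qed.

Definition odd_at h1 h2 h3 x y z := uniq [:: x; y; z] /\ odd_triple h1 h2 h3 x y z.

Section Fixed.
Variables h1 h2 h3 : I -> R.
Hypotheses (A1 : admissible h1) (A2 : admissible h2) (A3 : admissible h3).

Lemma odd_at12 x y z : odd_at h1 h2 h3 x y z -> odd_at h1 h2 h3 y x z.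
Proof.
move: A1 A2 A3 => [I1 _] [I2 _] [I3 _] [u o]; split.
  by rewrite uniq12.
by move: o; rewrite /odd_triple !(@midC12 _ x y z).
Qed.

Lemma odd_at23 x y z : odd_at h1 h2 h3 x y z -> odd_at h1 h2 h3 x z y.
Proof.
move: A1 A2 A3 => [I1 _] [I2 _] [I3 _] [u o]; split.
  by rewrite uniq23.
by move: o; rewrite /odd_triple !(@midC23 _ x y z).
Qed.

Lemma rainbow_extreme w x y z : uniq [:: w; x; y; z] -> rainbow h1 h2 h3 x y z ->
  [/\ h1 w < h1 x, h1 w < h1 y & h1 w < h1 z] \/
  [/\ h1 x < h1 w, h1 y < h1 w & h1 z < h1 w].
Proof.
set s := [:: w; x; y; z] => us rb.
have [I1 _] := A1; have [I2 _] := A2; have [I3 _] := A3.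
have [o1 c1] := @code_exists _ _ w s h1 I1 us erefl.
have [o2 c2] := @code_exists _ _ w s h2 I2 us erefl.
have [o3 c3] := @code_exists _ _ w s h3 I3 us erefl.
have cs := codes_consistent Dsym A1 A2 A3 c1 c2 c3.
have [[C1 H1] [C2 _] [C3 _]] := And3 c1 c2 c3.
have := check3P rainbow_check C1 C2 C3 cs.
rewrite -(rainbow_codeE us erefl c1 c2 c3) //= rb /=.
(* Positions are distinct and less than 4, so position 0 or 3 for [w], which has index 0, puts it
   below or above the three others. *)
have neq i : (0 < i < 4)%N -> index i o1 != index 0%N o1.
  move=> /andP[i0 i4]; apply/eqP => E.
  have := nth_index 0%N (_ : i \in o1); rewrite E nth_index ?code_mem //.
  by move=> /(_ i4) E'; rewrite -E' in i0.
have lt4 i : (i < 4)%N -> (index i o1 < 4)%N.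
  by move=> i4; have [_ <-] := code_uniq C1; rewrite index_mem code_mem.
move=> /orP[] /eqP E; [left|right].
- have B j : (0 < j < 4)%N -> h1 w < h1 (nth w s j).
    move=> j4; have := H1 0%N j isT; rewrite /= => ->; last by case/andP: j4.
    by move: (neq _ j4); rewrite /before E lt0n.
  by split; [exact: (B 1%N)|exact: (B 2%N)|exact: (B 3%N)].
- have B j : (0 < j < 4)%N -> h1 (nth w s j) < h1 w.
    move=> j4; have j4' : (j < 4)%N by case/andP: j4.
    have := H1 j 0%N j4' isT; rewrite [nth _ _ 0]/= => ->.
    move: (neq _ j4) (lt4 _ j4'); rewrite /before E ltnS leq_eqVlt.
    by move=> /negbTE ->.
  by split; [exact: (B 1%N)|exact: (B 2%N)|exact: (B 3%N)].
Qed.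

Hypothesis NR : forall x y z, uniq [:: x; y; z] -> ~~ rainbow h1 h2 h3 x y z.

Lemma odd_step w x y z : uniq [:: w; x; y; z] -> odd_triple h1 h2 h3 x y z ->
  ~~ odd_triple h2 h1 h3 w x y /\
  [|| odd_triple h1 h2 h3 w x y, odd_triple h1 h2 h3 w x z | odd_triple h1 h2 h3 w y z].
Proof.
set s := [:: w; x; y; z] => us od.
have [I1 _] := A1; have [I2 _] := A2; have [I3 _] := A3.
have [o1 c1] := @code_exists _ _ w s h1 I1 us erefl.
have [o2 c2] := @code_exists _ _ w s h2 I2 us erefl.
have [o3 c3] := @code_exists _ _ w s h3 I3 us erefl.
have cs := codes_consistent Dsym A1 A2 A3 c1 c2 c3.
have [[C1 _] [C2 _] [C3 _]] := And3 c1 c2 c3.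
have oE := odd_codeE us erefl c1 c2 c3; have rE := rainbow_codeE us erefl c1 c2 c3.
have := check3P odd_check C1 C2 C3 cs.
have nr : no_rainbow_code o1 o2 o3.
  move: us; rewrite /s /= !inE !negb_or => /and4P[/and3P[wx wy wz] /andP[xy xz] yz _].
  by apply/and4P; split; rewrite -rE //=; apply: NR; rewrite /= !inE !negb_or ?wx ?wy ?wz ?xy ?xz ?yz.
rewrite nr -!oE //= od /=.
by rewrite -(odd_codeE us erefl c2 c1 c3) //= => /andP[].
Qed.

End Fixed.
End Combinatorics.

Section Existence.
Variables (R : realDomainType) (I : eqType) (D : I -> I -> R).
Hypothesis Dsym : forall x y, D x y = D y x.
Implicit Types (h g : I -> R) (x y z w : I).

Notation admissible := (admissible D).

(** For injective heights: the two orders are neither equal nor reverse to each other, see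
    [not_differ]. *)
Definition differ h g :=
  exists x y z, uniq [:: x; y; z] /\ mid h x y z != mid g x y z.

Definition no_rainbow h1 h2 h3 :=
  forall x y z, uniq [:: x; y; z] -> ~~ rainbow h1 h2 h3 x y z.

Lemma no_rainbow12 h1 h2 h3 : no_rainbow h1 h2 h3 -> no_rainbow h2 h1 h3.
Proof.
move=> N x y z /N; apply: contra; rewrite /rainbow => /and3P[a b c].
by rewrite eq_sym a b c.
Qed.

Lemma no_rainbow23 h1 h2 h3 : no_rainbow h1 h2 h3 -> no_rainbow h1 h3 h2.
Proof.
move=> N x y z /N; apply: contra; rewrite /rainbow => /and3P[a b c].
by rewrite eq_sym in c; rewrite a b c.
Qed.

(** If [p] and [q] coincide, one triple has two odd ones out; otherwise the four elements, with [q]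
    at index 0, are excluded by the enumeration. *)
Lemma odd_share2 h1 h2 h3 x y p q :
  admissible h1 -> admissible h2 -> admissible h3 -> no_rainbow h1 h2 h3 ->
  odd_at h1 h2 h3 x y p -> odd_at h2 h1 h3 x y q -> False.
Proof.
move=> A1 A2 A3 NR o1 o2.
have [pq|pq] := eqVneq p q.
  move: o1 o2; rewrite pq => -[_ /andP[a /eqP b]] [_ /andP[_ /eqP d]].
  by rewrite b d eqxx in a.
have [I1 _] := A1; have [I2 _] := A2; have [I3 _] := A3.
have [u1 t1] := o1.
have [u2 t2] := odd_at12 A2 A1 A3 (odd_at23 A2 A1 A3 o2).
have us : uniq [:: q; x; y; p].
  move: u1 u2; rewrite /= !inE !negb_or !andbT (eq_sym q p) pq.
  by move=> /andP[/andP[-> ->] ->] /andP[/andP[-> ->] _].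
have [] := odd_step Dsym A1 A2 A3 NR us t1.
by rewrite t2.
Qed.

Lemma odd_spread h1 h2 h3 x y z w :
  admissible h1 -> admissible h2 -> admissible h3 -> no_rainbow h1 h2 h3 ->
  odd_at h1 h2 h3 x y z -> w \notin [:: x; y; z] ->
  [\/ odd_at h1 h2 h3 w x y, odd_at h1 h2 h3 w x z | odd_at h1 h2 h3 w y z].
Proof.
move=> A1 A2 A3 NR [u t] wn.
have us : uniq [:: w; x; y; z] by rewrite cons_uniq wn u.
have [_] := odd_step Dsym A1 A2 A3 NR us t.
move: us; rewrite /= !inE !negb_or !andbT => /and3P[/and3P[wx wy wz] /andP[xy xz] yz].
by case/or3P=> o; [constructor 1|constructor 2|constructor 3]; split => //;
  rewrite /= !inE !negb_or ?wx ?wy ?wz ?xy ?xz ?yz.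
Qed.

(** If there is no second common element, moving [b] into the first triple and then [p] into the
    second leads in every case to two triples with two common elements. *)
Lemma odd_share1 h1 h2 h3 a p q b c :
  admissible h1 -> admissible h2 -> admissible h3 -> no_rainbow h1 h2 h3 ->
  odd_at h1 h2 h3 a p q -> odd_at h2 h1 h3 a b c -> False.
Proof.
move=> A1 A2 A3 NR o1 o2; have NR' := no_rainbow12 NR.
have o1' := odd_at23 A1 A2 A3 o1; have o2' := odd_at23 A2 A1 A3 o2.
have S2 x y s t := @odd_share2 h1 h2 h3 x y s t A1 A2 A3 NR.
have [bp|bp] := eqVneq b p; first by apply: (S2 a p q c) => //; rewrite -bp.
have [bq|bq] := eqVneq b q; first by apply: (S2 a q p c) => //; rewrite -bq.
have [cp|cp] := eqVneq c p; first by apply: (S2 a p q b) => //; rewrite -cp.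
have [cq|cq] := eqVneq c q; first by apply: (S2 a q p b) => //; rewrite -cq.
have [u1 _] := o1; have [u2 _] := o2.
move: (u1) (u2); rewrite /= !inE !negb_or !andbT.
move=> /andP[/andP[ap aq] pq] /andP[/andP[ab ac] bc].
have bn : b \notin [:: a; p; q] by rewrite !inE !negb_or eq_sym ab bp bq.
have pn : p \notin [:: a; b; c].
  by rewrite !inE !negb_or eq_sym ap eq_sym bp eq_sym cp.
have sw := odd_at12 A1 A2 A3; have sw' := odd_at12 A2 A1 A3.
case: (odd_spread A1 A2 A3 NR o1 bn) => [/sw|/sw|] o3; [exact: (S2 a b p c)|exact: (S2 a b q c)|].
case: (odd_spread A2 A1 A3 NR' o2 pn) => [/sw'|/sw'|/sw'] o4;
  [exact: (S2 a p q b)|exact: (S2 a p q c)|exact: (S2 b p q c)].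
Qed.

(* The triples on which [h1] is the odd one out can be moved, one element at a
   time, towards those on which [h2] is, until they share two elements. *)
Lemma odd_disjoint h1 h2 h3 x y z a b c :
  admissible h1 -> admissible h2 -> admissible h3 -> no_rainbow h1 h2 h3 ->
  odd_at h1 h2 h3 x y z -> odd_at h2 h1 h3 a b c -> False.
Proof.
move=> A1 A2 A3 NR o1 o2.
have S1 p q o := @odd_share1 h1 h2 h3 a p q b c A1 A2 A3 NR o o2.
have [|an] := boolP (a \in [:: x; y; z]).
  rewrite !inE => /or3P[] /eqP E; move: o1; rewrite -E.
  - exact: S1.
  - by move/(odd_at12 A1 A2 A3); exact: S1.
  - by move/(odd_at23 A1 A2 A3)/(odd_at12 A1 A2 A3); exact: S1.
by case: (odd_spread A1 A2 A3 NR o1 an); exact: S1.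
Qed.

Lemma odd_triple23 h1 h2 h3 x y z : odd_at h1 h2 h3 x y z -> odd_at h1 h3 h2 x y z.
Proof. by move=> [u /andP[a /eqP b]]; split=> //; rewrite /odd_triple -b a eqxx. Qed.

(** Where [h1] and [h2] have different middles and there is no rainbow, [h3] must side with one of
    them. *)
Lemma differ_odd h1 h2 h3 : no_rainbow h1 h2 h3 -> differ h1 h2 ->
  (exists x y z, odd_at h1 h2 h3 x y z) \/ (exists x y z, odd_at h2 h1 h3 x y z).
Proof.
move=> NR [x [y [z [u d]]]].
have := NR x y z u; rewrite /rainbow d /= negb_and !negbK => /orP[] e;
  [right|left]; exists x, y, z; split => //; rewrite /odd_triple.
  by rewrite eq_sym d e.
by rewrite d e.
Qed.

(** By [odd_disjoint], without a rainbow only one of the three orders can ever be the odd one out,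
    whereas three pairwise differences produce two odd ones. *)
Lemma rainbow_exists h1 h2 h3 :
  admissible h1 -> admissible h2 -> admissible h3 ->
  differ h1 h2 -> differ h1 h3 -> differ h2 h3 ->
  exists x y z, uniq [:: x; y; z] /\ rainbow h1 h2 h3 x y z.
Proof.
move=> A1 A2 A3 d12 d13 d23; apply: contrapT => N.
have NR : no_rainbow h1 h2 h3.
  by move=> x y z u; apply/negP => r; apply: N; exists x, y, z.
have O12 := @odd_disjoint h1 h2 h3 _ _ _ _ _ _ A1 A2 A3 NR.
have O13 := @odd_disjoint h1 h3 h2 _ _ _ _ _ _ A1 A3 A2 (no_rainbow23 NR).
have O23 := @odd_disjoint h2 h3 h1 _ _ _ _ _ _ A2 A3 A1 (no_rainbow23 (no_rainbow12 NR)).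
have sw := odd_triple23.
case: (differ_odd NR d12) => -[x [y [z o]]].
  case: (differ_odd (no_rainbow23 (no_rainbow12 NR)) d23) => -[a [b [c o']]].
    exact: (O12 _ _ _ _ _ _ o (sw _ _ _ _ _ _ o')).
  exact: (O13 _ _ _ _ _ _ (sw _ _ _ _ _ _ o) (sw _ _ _ _ _ _ o')).
case: (differ_odd (no_rainbow23 NR) d13) => -[a [b [c o']]].
  exact: (O12 _ _ _ _ _ _ (sw _ _ _ _ _ _ o') o).
exact: (O23 _ _ _ _ _ _ (sw _ _ _ _ _ _ o) (sw _ _ _ _ _ _ o')).
Qed.

End Existence.

(** * The window of a rainbow triple *)

Section Structure.
Variables (R : realDomainType) (I : eqType) (D : I -> I -> R).
Hypothesis Dsym : forall x y, D x y = D y x.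
Implicit Types (h g : I -> R) (x y z w : I) (T : seq I).

Notation admissible := (admissible D).

Definition below h T w := forall t, t \in T -> h w < h t.
Definition above h T w := forall t, t \in T -> h t < h w.

Definition extreme h T := forall w, w \notin T -> below h T w \/ above h T w.

(** The pairs [a q] and [b p] exchange the roles of outer and inner pair, so each distance would be
    smaller than the other. The next two lemmas compare in this manner [a b] with [a q], and [a b]
    with [b y] or [b z]. *)
Lemma clash_swap h g a b p q : admissible h -> admissible g ->
  h a < h b -> h b < h p -> h p < h q -> g b < g a -> g a < g q -> g q < g p -> False.
Proof.
move=> [_ hD] [_ gD] h1 h2 h3 g1 g2 g3.
have [_ h4 _] := hD _ _ _ _ h1 h2 h3; have [_ g4 _] := gD _ _ _ _ g1 g2 g3.
by have := lt_trans h4 g4; rewrite ltxx.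
Qed.

Lemma clash_move h g a b p q : admissible h -> admissible g ->
  h a < h b -> h b < h p -> h p < h q -> g a < g q -> g q < g p -> g p < g b -> False.
Proof.
move=> [_ hD] [_ gD] h1 h2 h3 g1 g2 g3.
have [h4 _ _] := hD _ _ _ _ h1 h2 h3; have [g4 _ _] := gD _ _ _ _ g1 g2 g3.
by have := lt_trans h4 g4; rewrite ltxx.
Qed.

Lemma clash_jump h g a b x y z : admissible h -> admissible g -> y != z ->
  h b < h a -> h a < h x -> h x < h y -> h x < h z ->
  g a < g y -> g a < g z -> g y < g b -> g z < g b -> False.
Proof.
move=> [hI hD] [gI gD] yz h1 h2 h3 h4 g1 g2 g3 g4.
have [d1 _ _] := hD _ _ _ _ h1 h2 h3; have [d2 _ _] := hD _ _ _ _ h1 h2 h4.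
case: (ltgtP (g y) (g z)) => [l|l|/gI E]; last by rewrite E eqxx in yz.
  have [_ _ e] := gD _ _ _ _ g1 l g4.
  by rewrite (Dsym z b) (Dsym a b) in e; have := lt_trans d2 e; rewrite ltxx.
have [_ _ e] := gD _ _ _ _ g2 l g3; rewrite (Dsym y b) (Dsym a b) in e.
by have := lt_trans d1 e; rewrite ltxx.
Qed.

Lemma three_min h x y z : injective h -> uniq [:: x; y; z] ->
  exists t u v, [/\ t \in [:: x; y; z], u \in [:: x; y; z], v \in [:: x; y; z],
    u != v & h t < h u /\ h t < h v].
Proof.
move=> hI; rewrite /= !inE !negb_or !andbT => /andP[/andP[xy xz] yz].
case: (ltgtP (h x) (h y)) => [l1|l1|/hI E]; last by rewrite E eqxx in xy.
- case: (ltgtP (h x) (h z)) => [l2|l2|/hI E]; last by rewrite E eqxx in xz.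
  + by exists x, y, z; rewrite !inE !eqxx !orbT.
  + by exists z, x, y; rewrite !inE !eqxx !orbT; split=> //; rewrite l2 (lt_trans l2).
- case: (ltgtP (h y) (h z)) => [l2|l2|/hI E]; last by rewrite E eqxx in yz.
  + by exists y, x, z; rewrite !inE !eqxx !orbT.
  + by exists z, x, y; rewrite !inE !eqxx !orbT; split=> //; rewrite l2 (lt_trans l2).
Qed.

Lemma eq_mid h g x y z :
  (forall p q, p \in [:: x; y; z] -> q \in [:: x; y; z] -> (h p < h q) = (g p < g q)) ->
  mid h x y z = mid g x y z.
Proof.
by move=> E; rewrite /mid /middle /hlt !E // !inE !eqxx ?orbT.
Qed.

Lemma mid_flip h g x y z : injective h -> injective g ->
  mid h x y z != mid g x y z -> exists p q,
  [/\ p \in [:: x; y; z], q \in [:: x; y; z], h p < h q & g q < g p].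
Proof.
move=> hI gI ne; apply: contrapT => N; case/eqP: ne.
have mono p q : p \in [:: x; y; z] -> q \in [:: x; y; z] -> h p < h q -> g p < g q.
  move=> pT qT l; case: (ltgtP (g p) (g q)) => // [l'|/gI E].
    by case: N; exists p, q.
  by rewrite E ltxx in l.
apply: eq_mid => p q pT qT; apply/idP/idP; first exact: mono.
move=> l; case: (ltgtP (h p) (h q)) => // [/(mono _ _ qT pT) l'|/hI E].
  by have := lt_trans l l'; rewrite ltxx.
by rewrite E ltxx in l.
Qed.

Section Agree.
Variables (x y z : I).
Let T := [:: x; y; z].
Hypothesis uT : uniq T.

(** Otherwise [w] crosses the window while [a] stays. If [a] precedes [w] in [h], the inverted pair
    [p q] gives a [clash_move]; if it follows [w], there is a [clash_jump]. *)
Lemma below_agree h g a p q w : admissible h -> admissible g -> extreme g T ->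
  below h T a -> below g T a -> p \in T -> q \in T -> h p < h q -> g q < g p ->
  w \notin T -> below h T w -> below g T w.
Proof.
move=> A B eg ha ga pT qT hpq gqp wT hw; have [hI _] := A; have [gI _] := B.
case: (eg w wT) => // gw; exfalso.
case: (ltgtP (h a) (h w)) => [l|l|/hI E].
- exact: (clash_move A B l (hw _ pT) hpq (ga _ qT) gqp (gw _ pT)).
- have [t [u [v [tT uT' vT uv [l1 l2]]]]] := three_min hI uT.
  exact: (clash_jump A B uv l (ha _ tT) l1 l2 (ga _ uT') (ga _ vT) (gw _ uT') (gw _ vT)).
- by have := lt_trans (ga _ pT) (gw _ pT); rewrite E ltxx.
Qed.

(** By [clash_swap], two elements on the same side are not exchanged while [p q] is inverted. The
    side above the window is the side below it for the negated heights. *)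
Lemma outside_agree h g a p q v w : admissible h -> admissible g ->
  extreme h T -> extreme g T ->
  below h T a -> below g T a -> p \in T -> q \in T -> h p < h q -> g q < g p ->
  v \notin T -> w \notin T -> h v < h w -> g v < g w.
Proof.
move=> A B eh eg ha ga pT qT hpq gqp vT wT hvw; have [hI _] := A; have [gI _] := B.
have bl u := below_agree A B eg ha ga pT qT hpq gqp (w := u).
have bl' u := below_agree B A eh ga ha qT pT gqp hpq (w := u).
have ab u : u \notin T -> above h T u -> above g T u.
  move=> uT' hu; case: (eg u uT') => // /(bl' u uT') hu'.
  by have := lt_trans (hu _ pT) (hu' _ pT); rewrite ltxx.
case: (ltgtP (g v) (g w)) => // [l|/gI E]; last by rewrite E ltxx in hvw.
exfalso; case: (eh v vT) => hv; case: (eh w wT) => hw.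
- exact: (clash_swap A B hvw (hw _ pT) hpq l (bl _ vT hv _ qT) gqp).
- by have := lt_trans (lt_trans l (bl _ vT hv _ pT)) (ab _ wT hw _ pT); rewrite ltxx.
- by have := lt_trans (lt_trans (hw _ pT) (hv _ pT)) hvw; rewrite ltxx.
- apply: (clash_swap (admissibleN Dsym A) (admissibleN Dsym B) (a := w) (b := v) (p := q) (q := p));
    rewrite ?ltrN2 //; first exact: hv.
  exact: ab.
Qed.

End Agree.

Definition out_agree h g T :=
  (forall w, w \notin T -> below h T w -> below g T w) /\
  (forall v w, v \notin T -> w \notin T -> h v < h w -> g v < g w).

Lemma out_agree_trans h g k T : out_agree h g T -> out_agree g k T -> out_agree h k T.
Proof. by move=> [a b] [c d]; split=> *; [exact/c/a|exact/d/b]. Qed.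

Lemma belowN h T w : below (fun i => - h i) T w <-> above h T w.
Proof. by split=> H t /H; rewrite ltrN2. Qed.

Lemma aboveN h T w : above (fun i => - h i) T w <-> below h T w.
Proof. by split=> H t /H; rewrite ltrN2. Qed.

Lemma rainbow12 h1 h2 h3 x y z : rainbow h1 h2 h3 x y z -> rainbow h2 h1 h3 x y z.
Proof. by case/and3P=> a b c; apply/and3P; split=> //; rewrite eq_sym. Qed.

Lemma rainbow23 h1 h2 h3 x y z : rainbow h1 h2 h3 x y z -> rainbow h1 h3 h2 x y z.
Proof. by case/and3P=> a b c; apply/and3P; split=> //; rewrite eq_sym. Qed.

Lemma rainbow_extremes h1 h2 h3 x y z :
  admissible h1 -> admissible h2 -> admissible h3 -> uniq [:: x; y; z] ->
  rainbow h1 h2 h3 x y z -> extreme h1 [:: x; y; z].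
Proof.
move=> A1 A2 A3 u rb w wT.
have us : uniq [:: w; x; y; z] by rewrite cons_uniq wT.
case: (rainbow_extreme Dsym A1 A2 A3 us rb) => -[a b c]; [left|right] => t;
  by rewrite !inE => /or3P[] /eqP ->.
Qed.

(** Different middles supply the inverted pair that [below_agree] and [outside_agree] need. *)
Lemma rainbow_out_agree h1 h2 h3 x y z a (T := [:: x; y; z]) :
  admissible h1 -> admissible h2 -> admissible h3 -> uniq T ->
  rainbow h1 h2 h3 x y z -> below h1 T a -> below h2 T a -> out_agree h1 h2 T.
Proof.
move=> A1 A2 A3 u rb b1 b2.
have e1 := rainbow_extremes A1 A2 A3 u rb.
have e2 := rainbow_extremes A2 A1 A3 u (rainbow12 rb).
have [I1 _] := A1; have [I2 _] := A2; have /and3P[ne _ _] := rb.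
have [p [q [pT qT hpq gqp]]] := mid_flip I1 I2 ne.
split=> [w wT|v w vT wT].
  exact: (below_agree u A1 A2 e2 b1 b2 pT qT hpq gqp wT).
exact: (outside_agree u A1 A2 e1 e2 b1 b2 pT qT hpq gqp vT wT).
Qed.

(** A line may be traversed either way; the direction is chosen so that [a] comes before the
    window. *)
Lemma orient h T a : admissible h -> extreme h T -> a \notin T -> exists h',
  [/\ h' = h \/ h' = (fun i => - h i), admissible h', below h' T a
    & forall x y z, mid h' x y z = mid h x y z].
Proof.
move=> A E aT; case: (E a aT) => H.
  by exists h; split=> //; left.
exists (fun i => - h i); split; first by right.
- exact: admissibleN.
- by apply/belowN.
- by move=> x y z; rewrite midN.
Qed.

Lemma eq_mid_orders h g x y z (T := [:: x; y; z]) :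
  injective h -> injective g -> uniq T -> mid h x y z = mid g x y z ->
  (forall p q, p \in T -> q \in T -> (h p < h q) = (g p < g q)) \/
  (forall p q, p \in T -> q \in T -> (h p < h q) = (g q < g p)).
Proof.
rewrite /T => hI gI; rewrite /= !inE !negb_or !andbT => /andP[/andP[xy xz] yz].
have [yx zx zy] : [/\ y != x, z != x & z != y] by split; rewrite eq_sym.
move: (xy) (xz) (yz); rewrite -!(inj_eq gI).
move: (xy) (xz) (yz); rewrite -!(inj_eq hI) /mid /middle /hlt.
case: (ltgtP (h x) (h y)) => // a1 _; case: (ltgtP (h x) (h z)) => // a2 _;
case: (ltgtP (h y) (h z)) => // a3 _; try lt_cycle;
case: (ltgtP (g x) (g y)) => // b1 _; case: (ltgtP (g x) (g z)) => // b2 _;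
case: (ltgtP (g y) (g z)) => // b3 _ /= E; try lt_cycle;
try (by move: xy xz yz yx zx zy; rewrite E eqxx);
try (by left=> p q; rewrite !inE => /or3P[]/eqP-> /or3P[]/eqP->;
  rewrite ?ltxx ?a1 ?a2 ?a3 ?b1 ?b2 ?b3
    ?(lt_gtF a1) ?(lt_gtF a2) ?(lt_gtF a3) ?(lt_gtF b1) ?(lt_gtF b2) ?(lt_gtF b3));
by right=> p q; rewrite !inE => /or3P[]/eqP-> /or3P[]/eqP->;
  rewrite ?ltxx ?a1 ?a2 ?a3 ?b1 ?b2 ?b3
    ?(lt_gtF a1) ?(lt_gtF a2) ?(lt_gtF a3) ?(lt_gtF b1) ?(lt_gtF b2) ?(lt_gtF b3).
Qed.

End Structure.

(** * At most three orders; two of three orders rotate the window *)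

Section Conclusions.
Variables (R : realDomainType) (I : eqType) (D : I -> I -> R).
Hypothesis Dsym : forall x y, D x y = D y x.
Implicit Types (h g : I -> R) (x y z w : I) (T : seq I).

Notation admissible := (admissible D).

Lemma same_or_reversed_mid h g x y z :
  (forall p q, p \in [:: x; y; z] -> q \in [:: x; y; z] -> (h p < h q) = (g p < g q)) \/
  (forall p q, p \in [:: x; y; z] -> q \in [:: x; y; z] -> (h p < h q) = (g q < g p)) ->
  mid h x y z = mid g x y z.
Proof.
move=> [E|E]; first exact: eq_mid.
rewrite -[RHS]midN; apply: eq_mid => p q pT qT.
by rewrite ltrN2 E.
Qed.

(** Once oriented alike, the two orders agree outside the window, and inside it up to reversal; the
    distances from an outside element exclude the reversal. *)
Lemma rainbow_fourth h1 h2 h3 h4 x y z :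
  admissible h1 -> admissible h2 -> admissible h3 -> admissible h4 ->
  uniq [:: x; y; z] -> rainbow h1 h2 h3 x y z -> mid h1 x y z = mid h4 x y z ->
  differ h1 h4 -> False.
Proof.
move=> A1 A2 A3 A4 u rb m14; set T := [:: x; y; z].
have rb4 : rainbow h4 h2 h3 x y z by move: rb; rewrite /rainbow m14.
have [[I1 _] [I4 _]] := conj A1 A4.
move=> [p [q [r [_ /eqP[]]]]].
(* If the triple is everything, equal middles already settle the order up to reversal. *)
have [[a aT]|N] := pselect (exists a, a \notin T); last first.
  have inT t : t \in T by apply: contrapT => /negP tT; apply: N; exists t.
  apply: same_or_reversed_mid.
  by case: (eq_mid_orders I1 I4 u m14) => E; [left|right] => s t _ _; apply: E; exact: inT.
have e1 := rainbow_extremes Dsym A1 A2 A3 u rb.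
have e2 := rainbow_extremes Dsym A2 A1 A3 u (rainbow12 rb).
have e4 := rainbow_extremes Dsym A4 A2 A3 u rb4.
have [h1' [_ A1' b1 m1]] := orient Dsym A1 e1 aT.
have [h2' [_ A2' b2 m2]] := orient Dsym A2 e2 aT.
have [h4' [_ A4' b4 m4]] := orient Dsym A4 e4 aT.
have rb' : rainbow h1' h2' h3 x y z by rewrite /rainbow m1 m2.
have rb4' : rainbow h4' h2' h3 x y z by rewrite /rainbow m4 m2.
(* The comparison passes through [h2], because agreement outside the window is only known for orders
   with different middles. *)
have [ba wa] := out_agree_trans (rainbow_out_agree Dsym A1' A2' A3 u rb' b1 b2)
  (rainbow_out_agree Dsym A2' A4' A3 u (rainbow12 rb4') b2 b4).
have [ba' wa'] := out_agree_trans (rainbow_out_agree Dsym A4' A2' A3 u rb4' b4 b2)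
  (rainbow_out_agree Dsym A2' A1' A3 u (rainbow12 rb') b2 b1).
have e1' := rainbow_extremes Dsym A1' A2' A3 u rb'.
have e4' := rainbow_extremes Dsym A4' A2' A3 u rb4'.
have [[I1' D1] [I4' D4]] := conj A1' A4'.
have m14' : mid h1' x y z = mid h4' x y z by rewrite m1 m4.
have [E|E] := eq_mid_orders I1' I4' u m14'; last first.
  (* With the window reversed, the distances from [a] to its two end elements would each be smaller
     than the other. *)
  have [t [v [w [tT vT wT]]]] := three_min I1' u.
  wlog l : v w vT wT / h1' v < h1' w.
    move=> W vw [l1 l2]; case: (ltgtP (h1' v) (h1' w)) => [l|l|/I1' E'].
    - exact: (W v w).
    - by apply: (W w v) => //; rewrite eq_sym.
    - by rewrite E' eqxx in vw.
  move=> _ [l1 _].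
  have [d1 _ _] := D1 _ _ _ _ (b1 _ tT) l1 l.
  rewrite E // in l1; rewrite E // in l.
  have [d2 _ _] := D4 _ _ _ _ (b4 _ wT) l l1.
  by have := lt_trans d1 d2; rewrite ltxx.
rewrite -m1 -m4; apply: eq_mid => s t _ _.
suff mono h g : (forall p q : I, p \in T -> q \in T -> (h p < h q) = (g p < g q)) ->
    injective h -> extreme h T -> extreme g T -> out_agree h g T -> out_agree g h T ->
    forall s t, h s < h t -> g s < g t.
  apply/idP/idP; apply: mono => //.
  by move=> ? ? ? ?; rewrite E.
move=> {E} E hI eh eg [bhg whg] [bgh wgh] {}s {}t l.
have [sT|sT] := boolP (s \in T); have [tT|tT] := boolP (t \in T).
- by rewrite -E.
- case: (eg t tT) => [/(bgh _ tT) ht|]; last exact.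
  by have := lt_trans l (ht _ sT); rewrite ltxx.
- case: (eh s sT) => [/(bhg _ sT)|hs]; first exact.
  by have := lt_trans l (hs _ tT); rewrite ltxx.
- exact: whg.
Qed.

(** Three different middles exhaust the triple, so the fourth order shares its middle with one of
    the others. *)
Theorem no_four_orders h1 h2 h3 h4 :
  admissible h1 -> admissible h2 -> admissible h3 -> admissible h4 ->
  differ h1 h2 -> differ h1 h3 -> differ h1 h4 ->
  differ h2 h3 -> differ h2 h4 -> differ h3 h4 -> False.
Proof.
move=> A1 A2 A3 A4 d12 d13 d14 d23 d24 d34.
have [x [y [z [u rb]]]] := rainbow_exists Dsym A1 A2 A3 d12 d13 d23.
have : mid h4 x y z \in [:: mid h1 x y z; mid h2 x y z; mid h3 x y z].
  case/and3P: rb; move: (mid_mem h1 x y z) (mid_mem h2 x y z) (mid_mem h3 x y z).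
  move: (mid_mem h4 x y z); rewrite !inE.
  by do 4! (case/or3P=> /eqP->); rewrite ?eqxx ?orbT.
rewrite !inE => /or3P[] /eqP/esym E.
- exact: (rainbow_fourth A1 A2 A3 A4 u rb E).
- exact: (rainbow_fourth A2 A1 A3 A4 u (rainbow12 rb) E).
- exact: (rainbow_fourth A3 A1 A2 A4 u (rainbow12 (rainbow23 rb)) E).
Qed.

Definition sorted3 h x y z := h x < h y /\ h y < h z.

Lemma mid_sorted3 h x y z : uniq [:: x; y; z] -> mid h x y z = y ->
  sorted3 h x y z \/ sorted3 h z y x.
Proof.
rewrite /= !inE !negb_or !andbT => /andP[/andP[xy xz] yz].
rewrite /mid /middle; case: ifP => [/orP[] /andP[] a b _|_]; [by left|by right|].
by case: ifP => _ E; move: xy yz; rewrite E eqxx.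
Qed.

Lemma sorted3_mid h x y z : sorted3 h x y z -> mid h x y z = y.
Proof. by move=> [a b]; rewrite /mid /middle /hlt a b. Qed.

Lemma sort_three h x y z : injective h -> uniq [:: x; y; z] -> exists x' y' z',
  [/\ sorted3 h x' y' z', uniq [:: x'; y'; z'], [:: x; y; z] =i [:: x'; y'; z']
    & forall g, injective g -> mid g x' y' z' = mid g x y z].
Proof.
move=> hI u.
have u1 : uniq [:: y; x; z] by rewrite -uniq12.
have u2 : uniq [:: x; z; y] by rewrite -uniq23.
have sy x1 y1 z1 : [:: x1; y1; z1] =i [:: z1; y1; x1].
  by move=> t; rewrite !inE; case: (t == x1); case: (t == y1); case: (t == z1).
have rv x1 y1 z1 : uniq [:: x1; y1; z1] ->
    [/\ uniq [:: z1; y1; x1] & forall g, injective g -> mid g z1 y1 x1 = mid g x1 y1 z1].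
  move=> v; have v1 : uniq [:: y1; x1; z1] by rewrite -uniq12.
  have v2 : uniq [:: y1; z1; x1] by rewrite -uniq23.
  split=> [|g gI]; first by rewrite uniq12.
  by rewrite -(midC12 gI v2) -(midC23 gI v1) -(midC12 gI v).
have key x1 y1 z1 : uniq [:: x1; y1; z1] -> mid h x1 y1 z1 = y1 ->
    [:: x; y; z] =i [:: x1; y1; z1] ->
    (forall g, injective g -> mid g x1 y1 z1 = mid g x y z) -> exists x' y' z',
  [/\ sorted3 h x' y' z', uniq [:: x'; y'; z'], [:: x; y; z] =i [:: x'; y'; z']
    & forall g, injective g -> mid g x' y' z' = mid g x y z].
  move=> v m E gE; have [v' gE'] := rv _ _ _ v.
  case: (mid_sorted3 v m) => s; first by exists x1, y1, z1.
  exists z1, y1, x1; split=> // [t|g gI]; last by rewrite gE' ?gE.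
  by rewrite E sy.
have := mid_mem h x y z; rewrite !inE => /or3P[] /eqP m.
- apply: (key y x z) => // [|t|g gI]; first by rewrite -(midC12 hI u).
  + by rewrite !inE orbCA.
  + by rewrite -(midC12 gI u).
- exact: (key x y z).
- apply: (key x z y) => // [|t|g gI]; first by rewrite -(midC23 hI u).
  + by rewrite !inE; congr orb; rewrite orbC.
  + by rewrite -(midC23 gI u).
Qed.

Definition window h g T :=
  (forall w, w \notin T ->
     (below h T w /\ below g T w) \/ (above h T w /\ above g T w)) /\
  (forall v w, v \notin T -> w \notin T -> h v < h w -> g v < g w).

Lemma eq_window h g T T' : T =i T' -> window h g T -> window h g T'.
Proof.
move=> E [a b]; split=> [w wT|v w vT wT]; last by apply: b; rewrite E.
have : w \notin T by rewrite E.
by case/a => -[c d]; [left|right]; split=> t tT; [apply: c|apply: d|apply: c|apply: d]; rewrite E.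
Qed.

Lemma rainbow_window h1 h2 h3 x y z a (T := [:: x; y; z]) :
  admissible h1 -> admissible h2 -> admissible h3 -> uniq T ->
  rainbow h1 h2 h3 x y z -> below h1 T a -> below h2 T a -> window h1 h2 T.
Proof.
move=> A1 A2 A3 u rb b1 b2; have rb' := rainbow12 rb.
have e1 := rainbow_extremes Dsym A1 A2 A3 u rb.
have e2 := rainbow_extremes Dsym A2 A1 A3 u rb'.
have [c d] := rainbow_out_agree Dsym A1 A2 A3 u rb b1 b2.
have [c' d'] := rainbow_out_agree Dsym A2 A1 A3 u rb' b2 b1.
have xT : x \in T by rewrite !inE eqxx.
split=> // w wT; case: (e1 w wT) => [w1|w1]; first by left; split=> //; exact: c.
case: (e2 w wT) => [/(c' _ wT) w2|w2]; last by right.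
by have := lt_trans (w1 _ xT) (w2 _ xT); rewrite ltxx.
Qed.

(** Of three orders of the window two have the same parity; as their middles differ, they are cyclic
    rotations of each other. *)
Lemma rotation_exists (K : (I -> R) -> Prop) h1 h2 h3 :
  (forall h, K h -> admissible h) -> (forall h, K h -> K (fun i => - h i)) ->
  (forall T, size T = 3 -> exists a, a \notin T) ->
  K h1 -> K h2 -> K h3 -> differ h1 h2 -> differ h1 h3 -> differ h2 h3 ->
  exists h g x y z, [/\ K h, K g, sorted3 h x y z, sorted3 g z x y
    & window h g [:: x; y; z]].
Proof.
move=> KA KN big K1 K2 K3 d12 d13 d23.
have [A1 A2 A3] : [/\ admissible h1, admissible h2 & admissible h3] by split; exact: KA.
have [x [y [z [u rb]]]] := rainbow_exists Dsym A1 A2 A3 d12 d13 d23.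
have [a aT] := big [:: x; y; z] erefl.
have e1 := rainbow_extremes Dsym A1 A2 A3 u rb.
have e2 := rainbow_extremes Dsym A2 A1 A3 u (rainbow12 rb).
have e3 := rainbow_extremes Dsym A3 A1 A2 u (rainbow12 (rainbow23 rb)).
have [g1 [E1 B1 b1 m1]] := orient Dsym A1 e1 aT.
have [g2 [E2 B2 b2 m2]] := orient Dsym A2 e2 aT.
have [g3 [E3 B3 b3 m3]] := orient Dsym A3 e3 aT.
have {E1} L1 : K g1 by case: E1 => ->; [|exact: KN].
have {E2} L2 : K g2 by case: E2 => ->; [|exact: KN].
have {E3} L3 : K g3 by case: E3 => ->; [|exact: KN].
have {m1 m2 m3 rb} rb : rainbow g1 g2 g3 x y z by rewrite /rainbow m1 m2 m3.
have W12 := rainbow_window B1 B2 B3 u rb b1 b2.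
have W21 := rainbow_window B2 B1 B3 u (rainbow12 rb) b2 b1.
have W13 := rainbow_window B1 B3 B2 u (rainbow23 rb) b1 b3.
have W31 := rainbow_window B3 B1 B2 u (rainbow12 (rainbow23 rb)) b3 b1.
have W23 := rainbow_window B2 B3 B1 u (rainbow23 (rainbow12 rb)) b2 b3.
have W32 := rainbow_window B3 B2 B1 u (rainbow12 (rainbow23 (rainbow12 rb))) b3 b2.
have [[I1 _] [I2 _] [I3 _]] := And3 B1 B2 B3.
have [p [q [r [s1 v E mE]]]] := sort_three I1 u.
move: rb; rewrite /rainbow -!mE // (sorted3_mid s1) => /and3P[n2 n3 n23].
have cyc : [:: x; y; z] =i [:: q; r; p] by move=> t; rewrite E !inE; case: (t == p); case: (t == q); case: (t == r).
have swp : [:: x; y; z] =i [:: p; r; q] by move=> t; rewrite E !inE; case: (t == p); case: (t == q); case: (t == r).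
(* Compared with [p q r], an order with another middle is a rotation or one of [p r q] and
   [q p r]. *)
have opt g : injective g -> q != mid g p q r ->
    (sorted3 g q r p \/ sorted3 g r p q) \/
    (sorted3 g p r q /\ mid g p q r = r \/ sorted3 g q p r /\ mid g p q r = p).
  move=> gI nq; have := mid_mem g p q r; rewrite !inE => /or3P[] /eqP m.
  - have m' := m; rewrite midC12 // in m'; have v' : uniq [:: q; p; r] by rewrite -uniq12.
    by case: (mid_sorted3 v' m') => s; [right; right|left; right].
  - by rewrite m eqxx in nq.
  - have m' := m; rewrite midC23 // in m'; have v' : uniq [:: p; r; q] by rewrite -uniq23.
    by case: (mid_sorted3 v' m') => s; [right; left|left; left].
case: (opt g2 I2 n2) => [[s2|s2]|o2].
- by exists g2, g1, q, r, p; split=> //; exact: eq_window cyc _.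
- by exists g1, g2, p, q, r; split=> //; exact: eq_window E _.
case: (opt g3 I3 n3) => [[s3|s3]|o3].
- by exists g3, g1, q, r, p; split=> //; exact: eq_window cyc _.
- by exists g1, g3, p, q, r; split=> //; exact: eq_window E _.
(* Different middles leave only [p r q] and [q p r], which are rotations of each other. *)
case: o2 => -[s2 M2]; case: o3 => -[s3 M3]; try by rewrite M2 M3 eqxx in n23.
- by exists g2, g3, p, r, q; split=> //; exact: eq_window swp _.
- by exists g3, g2, p, r, q; split=> //; exact: eq_window swp _.
Qed.

End Conclusions.

(** * Distances along a transversal *)

Section Dot.
Variables (R : realType) (d : nat).
Implicit Types (x y z u v w : 'rV[R]_d) (a b : R).

Definition dot x y : R := \sum_(i < d) x 0 i * y 0 i.

Lemma dotC x y : dot x y = dot y x.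
Proof. by apply: eq_bigr => i _; rewrite mulrC. Qed.

Lemma dotDl x y z : dot (x + y) z = dot x z + dot y z.
Proof. by rewrite -big_split; apply: eq_bigr => i _; rewrite mxE mulrDl. Qed.

Lemma dotZl a x y : dot (a *: x) y = a * dot x y.
Proof. by rewrite mulr_sumr; apply: eq_bigr => i _; rewrite mxE mulrA. Qed.

Lemma dotNl x y : dot (- x) y = - dot x y.
Proof. by rewrite -scaleN1r dotZl mulN1r. Qed.

Lemma dotDr x y z : dot x (y + z) = dot x y + dot x z.
Proof. by rewrite dotC dotDl !(dotC _ x). Qed.

Lemma dotZr a x y : dot x (a *: y) = a * dot x y.
Proof. by rewrite dotC dotZl dotC. Qed.

Lemma dotNr x y : dot x (- y) = - dot x y.
Proof. by rewrite dotC dotNl dotC. Qed.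

Definition dotE := (dotDl, dotDr, dotNl, dotNr, dotZl, dotZr).

Lemma dot_ge0 x : 0 <= dot x x.
Proof. by apply: sumr_ge0 => i _; rewrite -expr2 sqr_ge0. Qed.

Lemma dot_eq0 x : dot x x = 0 -> x = 0.
Proof.
move/eqP; rewrite psumr_eq0 => [/allP H|i _]; last by rewrite -expr2 sqr_ge0.
apply/rowP => i; have := H i; rewrite mem_index_enum => /(_ isT) /=.
by rewrite mxE mulf_eq0 orbb => /eqP.
Qed.

Lemma dot_comb a b u v : dot (a *: u - b *: v) (a *: u - b *: v) =
  a ^+ 2 * dot u u + b ^+ 2 * dot v v - 2 * (a * b) * dot u v.
Proof. rewrite !dotE (dotC v u); ring. Qed.

(** Cauchy-Schwarz, from the square of [b *: u - a *: v]. The final division by [a * b] requires a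
    separate treatment of zero bounds, which force a zero vector. *)
Lemma dot_le_sqr u v a b : 0 <= a -> 0 <= b ->
  dot u u <= a ^+ 2 -> dot v v <= b ^+ 2 -> dot u v <= a * b.
Proof.
rewrite !le_eqVlt; case: eqP => [<- _ _|_ /= a0].
  rewrite expr0n /= mul0r [X in X || _]eq_sym => /orP[/eqP|].
    by move/esym => /dot_eq0 -> _; rewrite -(scale0r (0 : 'rV_d)) dotZl mul0r eqxx.
  by rewrite ltNge dot_ge0.
case: eqP => [<- _ _|_ /= b0].
  rewrite expr0n /= mulr0 [X in X || _]eq_sym => /orP[/eqP|].
    by move/esym => /dot_eq0 ->; rewrite -(scale0r (0 : 'rV_d)) dotZr mul0r eqxx.
  by rewrite ltNge dot_ge0.
rewrite -!le_eqVlt => ua vb.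
have := dot_ge0 (b *: u - a *: v); rewrite dot_comb => H.
have {}H : 2 * (a * b) * dot u v <= 2 * (a * b) * (a * b).
  have : b ^+ 2 * dot u u <= b ^+ 2 * a ^+ 2 by rewrite ler_wpM2l ?sqr_ge0.
  have : a ^+ 2 * dot v v <= a ^+ 2 * b ^+ 2 by rewrite ler_wpM2l ?sqr_ge0.
  by nra.
by rewrite ler_pM2l in H; rewrite ?mulr_gt0.
Qed.

(** The parallelogram law. *)
Lemma dot_sum_diff x y : dot (x + y) (x + y) = 2 * dot x x + 2 * dot y y - dot (x - y) (x - y).
Proof. rewrite !dotE (dotC y x); ring. Qed.

(* Two unit balls whose centers have height difference [a] and projections [x],
   [y] do not overlap. *)
Definition far x y a := 4 <= a ^+ 2 + dot (x - y) (x - y).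

End Dot.

Section Chain.
Variables (R : realType) (d : nat).
Variables (a b c e : 'rV[R]_d).
Hypotheses (a1 : dot a a <= 1) (b1 : dot b b <= 1) (c1 : dot c c <= 1) (e1 : dot e e <= 1).

(** By the parallelogram law, |x + y|^2 <= 4 - |x - y|^2. *)
Lemma far_sum (x y : 'rV[R]_d) (t : R) : dot x x <= 1 -> dot y y <= 1 -> far x y t ->
  dot (x + y) (x + y) <= t ^+ 2.
Proof. by rewrite /far (dot_sum_diff x y) => *; lra. Qed.

(** From a - c = (a + b) - (b + c) follows |a - c| <= s + t, so that [far a c (s + t)] reads 4 <=
    2(s + t)^2. *)
Lemma far_two_steps s t : 0 <= s -> 0 <= t -> far a b s -> far b c t ->
  far a c (s + t) -> 2 <= (s + t) ^+ 2.
Proof.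
move=> s0 t0 /(far_sum a1 b1) u /(far_sum b1 c1) v.
rewrite /far; have -> : a - c = (a + b) - (b + c) by rewrite opprD addrA addrK.
have : dot (- (a + b)) (b + c) <= s * t by apply: dot_le_sqr => //; rewrite dotNl dotNr opprK.
by rewrite dotNl !(dotDl (a + b)) !(dotDr _ (a + b)) !(dotNl (b + c)) !(dotNr _ (b + c)) (dotC (b + c)); nra.
Qed.

Variables (s t r : R).
Hypotheses (s0 : 0 <= s) (t0 : 0 <= t) (r0 : 0 <= r).
Hypotheses (fs : far a b s) (ft : far b c t) (fr : far c e r).

Let u := a + b.
Let v := - (b + c).
Let w := c + e.

Let uvw : a + e = u + v + w.
Proof.
by apply/rowP => i; rewrite !mxE; ring.
Qed.

(** The expansion of |u + v + w|^2 by [far_sum] and Cauchy-Schwarz. The slack of the four norms and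
    of the product of [v] and [w] is kept for the analysis of equality. *)
Lemma quadrangle_slack :
  dot (a + e) (a + e) + 2 * (1 - dot a a) + 2 * (1 - dot e e) +
    4 * (1 - dot b b) + 4 * (1 - dot c c) + 2 * (t * r - dot v w) <= (s + t + r) ^+ 2.
Proof.
move: a1 b1 c1 e1 => Ha Hb Hc He.
have su := far_sum a1 b1 fs; have sv := far_sum b1 c1 ft; have sw := far_sum c1 e1 fr.
have uv : dot u v <= s * t by apply: dot_le_sqr; rewrite // /v dotNl dotNr opprK.
have uw : dot u w <= s * r by apply: dot_le_sqr.
have {su} su : dot u u <= s ^+ 2 - 2 * (1 - dot a a) - 2 * (1 - dot b b).
  by move: fs; rewrite /far /u (dot_sum_diff a b); lra.
have {sv} sv : dot v v <= t ^+ 2 - 2 * (1 - dot b b) - 2 * (1 - dot c c).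
  by move: ft; rewrite /far /v dotNl dotNr opprK (dot_sum_diff b c); lra.
have {sw} sw : dot w w <= r ^+ 2 - 2 * (1 - dot c c) - 2 * (1 - dot e e).
  by move: fr; rewrite /far /w (dot_sum_diff c e); lra.
rewrite uvw !(dotDl _ w) !(dotDr _ _ w) !(dotDl u) !(dotDr _ u) (dotC w u) (dotC w v) (dotC v u).
by nra.
Qed.

Lemma quadrangle_le : 4 <= (s + t + r) ^+ 2 + dot (a - e) (a - e).
Proof.
move: a1 b1 c1 e1 => Ha Hb Hc He.
have sv := far_sum b1 c1 ft; have sw := far_sum c1 e1 fr.
have vw : dot v w <= t * r by apply: dot_le_sqr; rewrite // /v dotNl dotNr opprK.
by have := quadrangle_slack; rewrite (dot_sum_diff a e); lra.
Qed.

(* In case of equality, [c] is a unit vector and [b + c] and [c + e] point in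
   opposite directions; but both have a positive inner product with [c]. *)
Lemma quadrangle_lt : 0 < t -> 0 < r -> 4 < (s + t + r) ^+ 2 + dot (a - e) (a - e).
Proof.
move: a1 b1 c1 e1 => Ha Hb Hc He.
move=> t_gt0 r_gt0.
have sv := far_sum b1 c1 ft; have sw := far_sum c1 e1 fr.
have vw : dot v w <= t * r by apply: dot_le_sqr; rewrite // /v dotNl dotNr opprK.
rewrite lt_neqAle quadrangle_le andbT; apply/eqP => E.
have sl := quadrangle_slack; rewrite (dot_sum_diff a e) in sl.
have {vw} vw : dot v w = t * r by lra.
have cc : dot c c = 1 by lra.
have vv : dot v v <= t ^+ 2 by rewrite /v dotNl dotNr opprK.
have z : r *: v - t *: w = 0.
  apply: dot_eq0; apply/eqP; rewrite eq_le dot_ge0 andbT.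
  rewrite dot_comb.
  have : r ^+ 2 * dot v v <= r ^+ 2 * t ^+ 2 by rewrite ler_wpM2l ?sqr_ge0.
  have : t ^+ 2 * dot w w <= t ^+ 2 * r ^+ 2 by rewrite ler_wpM2l ?sqr_ge0.
  by rewrite vw; nra.
have : dot (r *: v - t *: w) c = 0 by rewrite z -(scale0r c) dotZl mul0r.
have -> : dot (r *: v - t *: w) c = - (r * (dot c c + dot b c) + t * (dot c c + dot c e)).
  by rewrite /v /w !dotE (dotC e c); ring.
have bc : dot (b + c) (b + c) = dot b b + 2 * dot b c + dot c c by rewrite !dotE (dotC c b); ring.
have ce : dot (c + e) (c + e) = dot c c + 2 * dot c e + dot e e by rewrite !dotE (dotC e c); ring.
have p1 : 0 <= dot c c + dot b c by have := dot_ge0 (b + c); lra.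
have p2 : 0 <= dot c c + dot c e by have := dot_ge0 (c + e); lra.
(* Both summands are nonnegative, hence zero. With |c| = 1 this forces c + e = 0, against
   [dot v w = t * r > 0]. *)
move=> /eqP; rewrite oppr_eq0 paddr_eq0 ?mulr_ge0 // !mulf_eq0 (gt_eqF r_gt0) (gt_eqF t_gt0) /= => /andP[_ /eqP p0].
have : dot w w = 0 by apply/eqP; rewrite eq_le dot_ge0 andbT /w ce; lra.
move/dot_eq0 => w0; move: vw; rewrite w0 -(scale0r v) dotZr mul0r.
by move/eqP; rewrite eq_sym mulf_eq0 !gt_eqF.
Qed.

End Chain.

Section FourDistances.
Variables (R : realType) (d : nat).
Implicit Types (a b c e : 'rV[R]_d) (s t r : R).

(* [s0] is the smallest height difference allowed by the projections. *)
Lemma far_gap a b s : 0 <= s -> dot a a <= 1 -> dot b b <= 1 -> far a b s ->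
  exists s0, [/\ 0 <= s0, s0 <= s & s0 ^+ 2 = 4 - dot (a - b) (a - b)].
Proof.
rewrite /far => s0 a1 b1 f.
have le4 : dot (a - b) (a - b) <= 4.
  by have := dot_ge0 (a + b); rewrite (dot_sum_diff a b); lra.
exists (Num.sqrt (4 - dot (a - b) (a - b))); rewrite sqrtr_ge0 sqr_sqrtr ?subr_ge0 //; split=> //.
by rewrite -(ler_pXn2r (n := 2)) ?nnegrE ?sqrtr_ge0 // sqr_sqrtr ?subr_ge0 //; lra.
Qed.

(** With [s] lowered to the contact value [g], the left side is 4 and [quadrangle_lt] applies.
    Raising [g] back to [s] increases the right side at least as much as the left. *)
Lemma four_dist_first a b c e s t r :
  dot a a <= 1 -> dot b b <= 1 -> dot c c <= 1 -> dot e e <= 1 ->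
  0 < s -> 0 < t -> 0 < r -> far a b s -> far b c t -> far c e r ->
  s ^+ 2 + dot (a - b) (a - b) < (s + t + r) ^+ 2 + dot (a - e) (a - e).
Proof.
move=> a1 b1 c1 e1 s0 t0 r0 fs ft fr.
have [g [g0 gs gE]] := far_gap (ltW s0) a1 b1 fs.
have fg : far a b g by rewrite /far gE subrK.
have := quadrangle_lt a1 b1 c1 e1 g0 (ltW t0) (ltW r0) fg ft fr t0 r0.
have : 0 <= (t + r) * (s - g) by rewrite mulr_ge0 ?subr_ge0 // addr_ge0 ?ltW.
by nra.
Qed.

Lemma four_dist_mid a b c e s t r :
  dot a a <= 1 -> dot b b <= 1 -> dot c c <= 1 -> dot e e <= 1 ->
  0 < s -> 0 < t -> 0 < r -> far a b s -> far b c t -> far c e r ->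
  t ^+ 2 + dot (b - c) (b - c) < (s + t + r) ^+ 2 + dot (a - e) (a - e).
Proof.
move=> a1 b1 c1 e1 s0 t0 r0 fs ft fr.
have [g [g0 gt gE]] := far_gap (ltW t0) b1 c1 ft.
have fg : far b c g by rewrite /far gE subrK.
have [{}gt|tg] := ltP g t.
  have := quadrangle_le a1 b1 c1 e1 (ltW s0) g0 (ltW r0) fs fg fr.
  have : 0 < (s + r) * (t - g) by rewrite mulr_gt0 ?subr_gt0 // addr_gt0.
  by nra.
have {tg gt} E : g = t by apply/le_anti; rewrite gt tg.
rewrite E in gE; have := quadrangle_lt a1 b1 c1 e1 (ltW s0) (ltW t0) (ltW r0) fs ft fr t0 r0.
by rewrite gE subrK.
Qed.

Lemma dot_subC a b : dot (a - b) (a - b) = dot (b - a) (b - a).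
Proof. by rewrite -opprB dotNl dotNr opprK. Qed.

Lemma far_sym a b s : far a b s -> far b a s.
Proof. by rewrite /far dot_subC. Qed.

End FourDistances.

Section Transversals.
Variables (R : realType) (d : nat) (I : eqType) (c : I -> 'rV[R]_d).
Implicit Types (v p x : 'rV[R]_d).

Definition height v (i : I) : R := dot v (c i).

Definition dist2 (i j : I) : R := dot (c i - c j) (c i - c j).

Definition perp v x := x - dot v x *: v.

(** The metric form of a line transversal; injectivity of the height replaces the condition on
    points of contact, see [height_inj]. *)
Definition transversal v p : Prop :=
  [/\ dot v v = 1, injective (height v)
    & forall i, dot (perp v (c i - p)) (perp v (c i - p)) <= 1].

Lemma dist2C i j : dist2 i j = dist2 j i.
Proof. exact: dot_subC. Qed.

Lemma perpB v p i j : perp v (c i - p) - perp v (c j - p) = perp v (c i - c j).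
Proof.
have -> : c i - c j = (c i - p) - (c j - p) by apply/rowP => k; rewrite !mxE; ring.
by apply/rowP => k; rewrite /perp !dotE !mxE; ring.
Qed.

Lemma dot_perp v x : dot v v = 1 -> dot (perp v x) (perp v x) = dot x x - dot v x ^+ 2.
Proof. by move=> v1; rewrite /perp !dotE v1 (dotC x v); ring. Qed.

Lemma heightB v i j : height v i - height v j = dot v (c i - c j).
Proof. by rewrite dotDr dotNr. Qed.

Lemma dist2E v p i j : transversal v p ->
  dist2 i j = (height v j - height v i) ^+ 2 +
    dot (perp v (c i - p) - perp v (c j - p)) (perp v (c i - p) - perp v (c j - p)).
Proof. by move=> [v1 _ _]; rewrite perpB dot_perp // -sqrrN opprB heightB addrC subrK. Qed.

Hypothesis sep : forall i j, i != j -> 4 <= dist2 i j.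

Lemma far_perp v p i j : transversal v p -> height v i < height v j ->
  far (perp v (c i - p)) (perp v (c j - p)) (height v j - height v i).
Proof.
move=> tv ij; have : 4 <= dist2 i j by apply: sep; apply: contraTneq ij => ->; rewrite ltxx.
by rewrite (dist2E _ _ tv).
Qed.

Lemma transversal_admissible v p : transversal v p -> admissible dist2 (height v).
Proof.
move=> tv; have [_ hI m1] := tv; split=> // x y z w xy yz zw.
have [fs ft fr] := And3 (far_perp tv xy) (far_perp tv yz) (far_perp tv zw).
move: (xy) (yz) (zw); rewrite -subr_gt0 -[_ _ y < _]subr_gt0 -[_ _ z < _]subr_gt0 => s0 t0 r0.
have E : height v w - height v x = (height v y - height v x) +
    (height v z - height v y) + (height v w - height v z) by ring.
rewrite !(dist2E _ _ tv) E; split.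
- exact: (four_dist_first (m1 x) (m1 y) (m1 z) (m1 w) s0 t0 r0 fs ft fr).
- exact: (four_dist_mid (m1 x) (m1 y) (m1 z) (m1 w) s0 t0 r0 fs ft fr).
(* The last pair is the first one when the line is traversed backwards. *)
- rewrite dot_subC (dot_subC (perp v (c x - p))) -[X in _ < X ^+ 2 + _]addrA [X in _ < X ^+ 2 + _]addrC
    [height v z - _ + _]addrC.
  exact: (four_dist_first (m1 w) (m1 z) (m1 y) (m1 x) r0 t0 s0 (far_sym fr) (far_sym ft) (far_sym fs)).
Qed.

Lemma height_two_steps v p i j k : transversal v p ->
  height v i < height v j -> height v j < height v k ->
  2 <= (height v k - height v i) ^+ 2.
Proof.
move=> tv ij jk; have [_ _ m1] := tv.
have f3 := far_perp tv (lt_trans ij jk).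
have E : height v k - height v i = (height v j - height v i) + (height v k - height v j) by ring.
rewrite E in f3 *.
apply: (far_two_steps (m1 i) (m1 j) (m1 k) _ _ (far_perp tv ij) (far_perp tv jk) f3);
  by rewrite subr_ge0 ltW.
Qed.

Lemma transversalN v p : transversal v p -> transversal (- v) p.
Proof.
move=> [v1 hI m1]; split=> [|i j|i]; first by rewrite dotNl dotNr opprK.
  by rewrite /height !dotNl => /oppr_inj /hI.
have -> : perp (- v) (c i - p) = perp v (c i - p).
  by rewrite /perp dotNl scalerN scaleNr opprK.
exact: m1.
Qed.

Lemma heightN v : height (- v) = fun i => - height v i.
Proof. by apply/funext => i; rewrite /height dotNl. Qed.

End Transversals.

(** * Two transversals *)

(** The inequality in which [no_three_before] ends, with [L] the root of 2. At L = 7/5, five times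
    the difference of the two sides is 35 t^2 (t - 1/7)^2 + 338/7 (t - 7/13)^2. *)
Lemma rotation_poly (R : realType) (L t : R) : 7 / 5 <= L -> 0 < t ->
  L * ((1 + t) ^+ 2 * (2 + 5 * t ^+ 2)) <= 16 * t * (1 + t ^+ 2) -> False.
Proof.
move=> L75 t0 H.
have m : 7 / 5 * ((1 + t) ^+ 2 * (2 + 5 * t ^+ 2)) <= L * ((1 + t) ^+ 2 * (2 + 5 * t ^+ 2)).
  by rewrite ler_wpM2r // mulr_ge0 ?sqr_ge0 // addr_ge0 // mulr_ge0 // sqr_ge0.
(* The two squares have no common zero. *)
have {m H} le0 : 35 * (t * (t - 1 / 7)) ^+ 2 + 338 / 7 * (t - 7 / 13) ^+ 2 <= 0.
  by move: (le_trans m H); nra.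
have n1 := sqr_ge0 (t * (t - 1 / 7)); have n2 := sqr_ge0 (t - 7 / 13).
have /eqP : (t - 7 / 13) ^+ 2 = 0 by lra.
by rewrite sqrf_eq0 subr_eq0 => /eqP E; rewrite E in le0; lra.
Qed.

Section Crossing.
Variables (R : realType) (I : eqType).

(* Two crossing transversals with angle [2 * atan T], projected to the plane
   they span: [r i] and [q i] are the signed distances of the center [i] from
   the first and second line, [h1 i] and [h2 i] its heights along them. *)
Record crossing (T : R) (h1 h2 r q : I -> R) : Prop := Crossing {
  crossing_gt0 : 0 < T;
  crossing_sub : forall i j,
    (q i - q j) - (r i - r j) = T * ((h1 i - h1 j) + (h2 i - h2 j));
  crossing_add : forall i j,
    T * ((q i - q j) + (r i - r j)) = (h1 i - h1 j) - (h2 i - h2 j);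
  crossing_r : forall i, -1 <= r i /\ r i <= 1;
  crossing_q : forall i, -1 <= q i /\ q i <= 1;
  crossing_r2 : forall i j, h1 i < h1 j ->
    h1 i - h1 j <= r i + r j /\ r i + r j <= h1 j - h1 i;
  crossing_q2 : forall i j, h2 i < h2 j ->
    h2 i - h2 j <= q i + q j /\ q i + q j <= h2 j - h2 i;
  crossing_h1 : forall i j k, h1 i < h1 j -> h1 j < h1 k -> 2 <= (h1 k - h1 i) ^+ 2;
  crossing_h2 : forall i j k, h2 i < h2 j -> h2 j < h2 k -> 2 <= (h2 k - h2 i) ^+ 2
}.

Variables (T : R) (h1 h2 r q : I -> R).
Hypothesis C : crossing T h1 h2 r q.

(* The coordinate along the bisector of the two lines, scaled so that the rhombus
   extends from -2 to 2. *)
Let X i := q i - r i.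
(** A lower bound, from [far_two_steps], for the height difference of two balls with a third one
    between them. *)
Let K : R := Num.sqrt 2.

Lemma sqrt2_bounds : 7 / 5 <= Num.sqrt 2 :> R /\ (Num.sqrt 2 : R) ^+ 2 = 2.
Proof.
have E : (Num.sqrt 2 : R) ^+ 2 = 2 by rewrite sqr_sqrtr.
split=> //; rewrite -(ler_pXn2r (n := 2)) ?nnegrE ?sqrtr_ge0 ?E //; lra.
Qed.

Lemma sqrt2_le (t : R) : 0 <= t -> 2 <= t ^+ 2 -> Num.sqrt 2 <= t.
Proof.
move=> t0 H; have [_ E] := sqrt2_bounds.
by rewrite -(ler_pXn2r (n := 2)) ?nnegrE ?sqrtr_ge0 ?E.
Qed.

Lemma step1 i j k : h1 i < h1 j -> h1 j < h1 k -> K <= h1 k - h1 i.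
Proof.
move=> a b; apply: sqrt2_le; first by rewrite subr_ge0 ltW // (lt_trans a).
exact: crossing_h1 C _ _ _ a b.
Qed.

Lemma step2 i j k : h2 i < h2 j -> h2 j < h2 k -> K <= h2 k - h2 i.
Proof.
move=> a b; apply: sqrt2_le; first by rewrite subr_ge0 ltW // (lt_trans a).
exact: crossing_h2 C _ _ _ a b.
Qed.

(** The bounds on r i + r j and q i + q j by the height differences combine to T |X i + X j| <= X j
    - X i; the last two claims are its two signs. *)
Lemma same_order i j : h1 i < h1 j -> h2 i < h2 j ->
  [/\ X i < X j, X i * (1 - T) <= X j * (1 + T) & X i * (1 + T) <= X j * (1 - T)].
Proof.
move=> a b; have [r1 r2] := crossing_r2 C a; have [q1 q2] := crossing_q2 C b.
have T0 := crossing_gt0 C; have E := crossing_sub C j i.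
have E' : X j - X i = T * (h1 j - h1 i + (h2 j - h2 i)) by rewrite -E /X; ring.
have l1 : T * (- (X i + X j)) <= X j - X i.
  by rewrite E' ler_pM2l // /X; lra.
have l2 : T * (X i + X j) <= X j - X i.
  by rewrite E' ler_pM2l // /X; lra.
have l3 : 0 < X j - X i by rewrite E' mulr_gt0 //; lra.
by split; lra.
Qed.

Lemma X_bounds i : -2 <= X i /\ X i <= 2.
Proof. by have [? ?] := crossing_r C i; have [? ?] := crossing_q C i; rewrite /X; split; lra. Qed.

Lemma X_diff i j a b : a <= h1 j - h1 i -> b <= h2 j - h2 i -> T * (a + b) <= X j - X i.
Proof.
move=> ha hb; have -> : X j - X i = T * (h1 j - h1 i + (h2 j - h2 i)).
  by rewrite -(crossing_sub C) /X; ring.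
by rewrite ler_pM2l ?(crossing_gt0 C) // lerD.
Qed.

(** The ball [z] is last on the first line and first on the second, so across the bisector it lies
    well apart from [x] and [y]; this bounds the angle from below. *)
Lemma rotation_gap x y z : sorted3 h1 x y z -> sorted3 h2 z x y ->
  2 * K <= T * (2 * (q z + r z) - (q x + r x) - (q y + r y)).
Proof.
move=> [a b] [e f]; have s1 := step1 a b; have s2 := step2 e f.
have E1 := crossing_add C z x; have E2 := crossing_add C z y.
have -> : T * (2 * (q z + r z) - (q x + r x) - (q y + r y)) =
  T * (q z - q x + (r z - r x)) + T * (q z - q y + (r z - r y)) by ring.
by rewrite E1 E2; lra.
Qed.

(** The window keeps [a2] and [b1] at least 4KT apart in [X], while [a1] and [b2], which lie in the
    rhombus as well, push them away from its tips. *)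
Lemma no_two_two a1 a2 x y z b1 b2 :
  sorted3 h1 x y z -> sorted3 h2 z x y ->
  h1 a1 < h1 a2 -> h1 a2 < h1 x -> h1 z < h1 b1 -> h1 b1 < h1 b2 ->
  h2 a1 < h2 a2 -> h2 a2 < h2 z -> h2 y < h2 b1 -> h2 b1 < h2 b2 -> False.
Proof.
move=> s1 s2 A1 A2 A3 A4 B1 B2 B3 B4.
have G := rotation_gap s1 s2; have [a b] := s1; have [e f] := s2.
have [K1 K2] := sqrt2_bounds; rewrite -/K in K1 K2.
have T0 := crossing_gt0 C.
have g1 := step1 A2 a; have g2 := step1 b A3; have g3 := step2 B2 e; have g4 := step2 f B3.
have d : T * (2 * K + 2 * K) <= X b1 - X a2 by apply: X_diff; lra.
have [l1 l2 _] := same_order A1 B1; have [l3 _ l4] := same_order A4 B4.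
have [xa _] := X_bounds a1; have [_ xb] := X_bounds b2.
(* Up to a right angle, [1 - T] is nonnegative and the tips -2 and 2 can be inserted into
   [same_order]. *)
have [T1|T1] := leP T 1.
- have m1 : -2 * (1 - T) <= X a1 * (1 - T) by rewrite ler_wpM2r ?subr_ge0.
  have m2 : X b2 * (1 - T) <= 2 * (1 - T) by rewrite ler_wpM2r ?subr_ge0.
  have m3 : T * (2 * K + 2 * K) * (1 + T) <= (X b1 - X a2) * (1 + T) by rewrite ler_wpM2r; lra.
  have g : K <= 4 * T.
    have [? ?] := crossing_r C x; have [? ?] := crossing_r C y; have [? ?] := crossing_r C z.
    have [? ?] := crossing_q C x; have [? ?] := crossing_q C y; have [? ?] := crossing_q C z.
    have : T * (2 * (q z + r z) - (q x + r x) - (q y + r y)) <= T * 8 by rewrite ler_pM2l //; lra.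
    by lra.
  (* Since 4KT >= 2, the inequality 4KT(1 + T) <= 4(1 - T) would give T <= 1/3, but T >= K/4 >=
     7/20. *)
  have k1 : 2 <= 4 * (K * T) by rewrite -K2; nra.
  have k2 : 2 * T <= 4 * (K * T) * T by rewrite ler_pM2r.
  by nra.
(* Beyond a right angle, [same_order] alone makes [X] nonnegative for the later and nonpositive for
   the earlier ball of a pair. *)
- have p1 : 0 <= X a2.
    rewrite leNgt; apply/negP => n.
    have : X a1 * (1 - T) > X a2 * (1 - T) by rewrite ltr_nM2r // subr_lt0.
    have : X a2 * (1 - T) - X a2 * (1 + T) >= 0 by nra.
    by lra.
  have p2 : X b1 <= 0.
    rewrite leNgt; apply/negP => n.
    have : X b2 * (1 - T) < X b1 * (1 - T) by rewrite ltr_nM2r // subr_lt0.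
    have : X b1 * (1 + T) - X b1 * (1 - T) >= 0 by nra.
    by lra.
  have : 0 < T * (2 * K + 2 * K) by rewrite mulr_gt0 //; lra.
  by lra.
Qed.

(** The rotation bounds [X] on the window from above and [a3] bounds it from below. For T <= 1, each
    of the two predecessors of [a3] contributes a factor (1 - T)/(1 + T) to its distance from the
    tip -2. *)
Lemma no_three_before a1 a2 a3 x y z :
  sorted3 h1 x y z -> sorted3 h2 z x y ->
  h1 a1 < h1 a2 -> h1 a2 < h1 a3 -> h1 a3 < h1 x ->
  h2 a1 < h2 a2 -> h2 a2 < h2 a3 -> h2 a3 < h2 z -> False.
Proof.
move=> s1 s2 A1 A2 A3 B1 B2 B3.
have G := rotation_gap s1 s2; have [a b] := s1; have [e f] := s2.
have [K1 K2] := sqrt2_bounds; rewrite -/K in K1 K2.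
have T0 := crossing_gt0 C.
have g1 := step1 A3 a; have g2 := step2 B3 e.
have d1 : T * (K + 0) <= X z - X a3 by apply: X_diff; lra.
have d2 : T * (0 + K) <= X x - X a3 by apply: X_diff; lra.
have d3 : T * (K + K) <= X y - X a3 by apply: X_diff; lra.
have [l1 l2 _] := same_order A1 B1; have [l3 l4 _] := same_order A2 B2.
have [xa _] := X_bounds a1.
have [rx _] := crossing_r C x; have [ry _] := crossing_r C y; have [_ qz] := crossing_q C z.
(* With the weights 2, 1, 1 the coordinates [r z], [q x] and [q y] cancel against [rotation_gap];
   the others are at most one in modulus. *)
have up : 2 * K + T * (2 * X z + X x + X y) <= T * 8.
  have : T * (4 * q z - 2 * r x - 2 * r y) <= T * 8 by rewrite ler_pM2l //; lra.
  by rewrite /X; lra.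
(* The coefficient 5 is 2 + 1 + 2, from [d1] with weight 2, [d2] and [d3]. *)
have low : T * (4 * X a3 + 5 * (K * T)) <= T * (2 * X z + X x + X y).
  by rewrite ler_pM2l //; lra.
have {up low} M : 2 * K + T * (4 * X a3 + 5 * (K * T)) <= T * 8 by lra.
have [T1|T1] := leP T 1.
- have m1 : -2 * (1 - T) <= X a1 * (1 - T) by rewrite ler_wpM2r ?subr_ge0.
  have m2 : (-2 * (1 - T)) * (1 - T) <= (X a2 * (1 + T)) * (1 - T).
    by rewrite ler_wpM2r ?subr_ge0 //; lra.
  have m3 : (X a2 * (1 - T)) * (1 + T) <= (X a3 * (1 + T)) * (1 + T) by rewrite ler_wpM2r //; lra.
  have m4 : -2 * (1 - T) ^+ 2 <= X a3 * (1 + T) ^+ 2 by nra.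
  have m5 : (2 * K + T * (4 * X a3 + 5 * (K * T))) * (1 + T) ^+ 2 <= T * 8 * (1 + T) ^+ 2.
    by rewrite ler_wpM2r ?sqr_ge0.
  have m6 : 4 * T * (-2 * (1 - T) ^+ 2) <= 4 * T * (X a3 * (1 + T) ^+ 2).
    by rewrite ler_wpM2l // mulr_ge0 // ltW.
  have m7 : K * ((1 + T) ^+ 2 * (2 + 5 * T ^+ 2)) <= 16 * T * (1 + T ^+ 2) by nra.
  exact: rotation_poly m7.
- have p1 : 0 <= X a2.
    rewrite leNgt; apply/negP => n.
    have : X a1 * (1 - T) > X a2 * (1 - T) by rewrite ltr_nM2r // subr_lt0.
    have : X a2 * (1 - T) - X a2 * (1 + T) >= 0 by nra.
    by lra.
  have m1 : 0 <= T * X a3 by rewrite mulr_ge0 // ?ltW //; lra.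
  (* As X a3 >= 0, it remains that 2K + 5KT^2 <= 8T, whose discriminant is negative for K >= 7/5. *)
  have m2 : 7 / 5 * (2 + 5 * T ^+ 2) <= K * (2 + 5 * T ^+ 2) by rewrite ler_wpM2r //; nra.
  by nra.
Qed.

End Crossing.

(** * From two transversals in space to a crossing in the plane *)

Section TwoLines.
Variables (R : realType) (d : nat) (I : eqType) (c : I -> 'rV[R]_d).
Implicit Types (v p n : 'rV[R]_d).
Hypothesis sep : forall i j, i != j -> 4 <= dist2 c i j.

Lemma dot_unit_bound n (x : 'rV[R]_d) (a : R) : 0 <= a -> dot n n = 1 -> dot x x <= a ^+ 2 ->
  - a <= dot n x /\ dot n x <= a.
Proof.
move=> a0 n1 xa; have n1' : dot n n <= 1 ^+ 2 by rewrite n1 expr1n.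
split; last by have := dot_le_sqr ler01 a0 n1' xa; rewrite mul1r.
have n2 : dot (- n) (- n) <= 1 ^+ 2 by rewrite dotNl dotNr opprK.
by have := dot_le_sqr ler01 a0 n2 xa; rewrite mul1r dotNl lerNl.
Qed.

Section Normal.
Variables (v p n : 'rV[R]_d).
Hypotheses (tv : transversal c v p) (n1 : dot n n = 1) (nv : dot n v = 0).

Lemma dot_normal_perp x : dot n (perp v x) = dot n x.
Proof. by rewrite /perp !dotE nv mulr0 oppr0 addr0. Qed.

Lemma normal_bound i : -1 <= dot n (c i - p) /\ dot n (c i - p) <= 1.
Proof.
have [_ _ m1] := tv; rewrite -dot_normal_perp; apply: dot_unit_bound => //.
by rewrite expr1n.
Qed.

Lemma normal_bound2 i j : height c v i < height c v j ->
  height c v i - height c v j <= dot n (c i - p) + dot n (c j - p) /\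
  dot n (c i - p) + dot n (c j - p) <= height c v j - height c v i.
Proof.
move=> ij; have [_ _ m1] := tv.
have := far_sum (m1 i) (m1 j) (far_perp sep tv ij).
rewrite -(dot_normal_perp (c i - p)) -(dot_normal_perp (c j - p)) -dotDr -[height c v i - height c v j]opprB.
by move=> H; apply: dot_unit_bound => //; rewrite subr_ge0 ltW.
Qed.

End Normal.

(** The two directions span a plane, and the signed distances are taken along the normals of the
    lines in it. The base points cancel from all differences, so the lines may be skew. *)
Lemma crossing_exists v1 p1 v2 p2 : transversal c v1 p1 -> transversal c v2 p2 ->
  v1 <> v2 -> v1 <> - v2 ->
  exists T r q, crossing T (height c v1) (height c v2) r q.
Proof.
move=> t1 t2 ne nN; have [u1 _ _] := t1; have [u2 _ _] := t2.
set k := dot v1 v2.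
have kC : dot v2 v1 = k by rewrite dotC.
have k1 : k < 1.
  have : dot (v1 - v2) (v1 - v2) != 0 by apply/eqP => /dot_eq0 /eqP; rewrite subr_eq0 => /eqP.
  by have := dot_ge0 (v1 - v2); rewrite le0r => /orP[->//|]; rewrite !dotE u1 u2 kC -/k; lra.
have k2 : -1 < k.
  have : dot (v1 + v2) (v1 + v2) != 0 by apply/eqP => /dot_eq0 /eqP; rewrite addr_eq0 => /eqP.
  by have := dot_ge0 (v1 + v2); rewrite le0r => /orP[->//|]; rewrite !dotE u1 u2 kC -/k; lra.
have s2 : 0 < 1 - k ^+ 2 by nra.
set s := Num.sqrt (1 - k ^+ 2).
have s0 : 0 < s by rewrite sqrtr_gt0.
have sE : s ^+ 2 = 1 - k ^+ 2 by rewrite sqr_sqrtr ?ltW.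
have sn : s != 0 by rewrite gt_eqF.
(* Here [k] and [s] are the cosine and sine of the angle of the lines. The signs of the normals are
   those for which both identities hold with the tangent (1 - k)/s of half the angle. *)
pose n1 := (k / s) *: v1 - s^-1 *: v2; pose n2 := s^-1 *: v1 - (k / s) *: v2.
have n11 : dot n1 n1 = 1.
  rewrite dot_comb u1 u2 -/k.
  have -> : (k / s) ^+ 2 * 1 + (s^-1) ^+ 2 * 1 - 2 * (k / s * s^-1) * k = (1 - k ^+ 2) / s ^+ 2 by field.
  by rewrite -sE divff // expf_neq0.
have n22 : dot n2 n2 = 1.
  rewrite dot_comb u1 u2 -/k.
  have -> : (s^-1) ^+ 2 * 1 + (k / s) ^+ 2 * 1 - 2 * (s^-1 * (k / s)) * k = (1 - k ^+ 2) / s ^+ 2 by field.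
  by rewrite -sE divff // expf_neq0.
have n1v : dot n1 v1 = 0 by rewrite /n1 !dotE u1 kC; field.
have n2v : dot n2 v2 = 0 by rewrite /n2 !dotE u2 -/k; field.
have dn1 i j : dot n1 (c i - p1) - dot n1 (c j - p1) =
    (k * (height c v1 i - height c v1 j) - (height c v2 i - height c v2 j)) / s.
  by rewrite /height /n1 !dotE; field.
have dn2 i j : dot n2 (c i - p2) - dot n2 (c j - p2) =
    ((height c v1 i - height c v1 j) - k * (height c v2 i - height c v2 j)) / s.
  by rewrite /height /n2 !dotE; field.
exists ((1 - k) / s), (fun i => dot n1 (c i - p1)), (fun i => dot n2 (c i - p2)).
split.
- by rewrite divr_gt0 ?subr_gt0.
- by move=> i j; rewrite dn1 dn2; field.
- move=> i j; rewrite dn1 dn2.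
  transitivity ((1 - k ^+ 2) / s ^+ 2 *
    ((height c v1 i - height c v1 j) - (height c v2 i - height c v2 j))); first by field.
  by rewrite -sE divff ?mul1r // expf_neq0.
- exact: (normal_bound t1 n11 n1v).
- exact: (normal_bound t2 n22 n2v).
- exact: (normal_bound2 t1 n11 n1v).
- exact: (normal_bound2 t2 n22 n2v).
- by move=> i j l a b; exact: (height_two_steps sep t1 a b).
- by move=> i j l a b; exact: (height_two_steps sep t2 a b).
Qed.

Definition is_height h := exists v p, transversal c v p /\ h = height c v.

Lemma is_heightN h : is_height h -> is_height (fun i => - h i).
Proof.
move=> [v [p [tv ->]]]; exists (- v), p; split; first exact: transversalN.
by rewrite heightN.
Qed.

Lemma is_height_admissible h : is_height h -> admissible (dist2 c) h.
Proof. by move=> [v [p [tv ->]]]; exact: transversal_admissible tv. Qed.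

(** A rotation of three elements is neither the same order nor the reverse one, so the directions
    are neither equal nor opposite. *)
Lemma rotation_crossing h g x y z : is_height h -> is_height g ->
  sorted3 h x y z -> sorted3 g z x y -> exists T r q, crossing T h g r q.
Proof.
move=> [v1 [p1 [t1 ->]]] [v2 [p2 [t2 ->]]] [a b] [e f].
apply: (crossing_exists t1 t2) => E; rewrite E in a b.
  by have := lt_trans b e; rewrite /height; lra.
by move: a f; rewrite heightN ltrN2 => /lt_trans /[apply]; rewrite ltxx.
Qed.

Lemma no_three_below h g x y z w : is_height h -> is_height g ->
  sorted3 h x y z -> sorted3 g z x y -> window h g [:: x; y; z] ->
  uniq w -> size w = 3 -> {in w, forall i, i \notin [:: x; y; z] /\ below h [:: x; y; z] i} -> False.
Proof.
move=> Kh Kg sh sg [W1 W2] uw sw Hw.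
have [T [r [q C]]] := rotation_crossing Kh Kg sh sg.
have [hI _] := is_height_admissible Kh.
move: w sw uw Hw => [|a1 [|a2 [|a3 [|//]]]] // _ uw Hw.
have [a [b [e [[ab be] _ E _]]]] := sort_three hI uw.
have inw i : i \in [:: a; b; e] -> i \notin [:: x; y; z] /\ below h [:: x; y; z] i.
  by rewrite -E; exact: Hw.
have [aT _] : a \notin [:: x; y; z] /\ below h [:: x; y; z] a by apply: inw; rewrite !inE eqxx.
have [bT _] : b \notin [:: x; y; z] /\ below h [:: x; y; z] b by apply: inw; rewrite !inE eqxx orbT.
have [eT eB] : e \notin [:: x; y; z] /\ below h [:: x; y; z] e by apply: inw; rewrite !inE eqxx !orbT.
have xT : x \in [:: x; y; z] by rewrite !inE eqxx.
have zT : z \in [:: x; y; z] by rewrite !inE eqxx !orbT.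
have eB' : below g [:: x; y; z] e.
  case: (W1 e eT) => -[] // eA _.
  by have := lt_trans (eA _ xT) (eB _ xT); rewrite ltxx.
exact: (no_three_before C sh sg ab be (eB _ xT) (W2 _ _ aT bT ab) (W2 _ _ bT eT be) (eB' _ zT)).
Qed.

(** Reversal turns the orders [x y z] and [z x y] into [z y x] and [y x z], the same pattern with
    the two lines exchanged. Thus balls above the window reduce to balls below it. *)
Lemma windowN (h g : I -> R) (x y z : I) : injective h -> injective g -> window h g [:: x; y; z] ->
  window (fun i => - g i) (fun i => - h i) [:: y; x; z].
Proof.
move=> hI gI [W1 W2].
have E : [:: x; y; z] =i [:: y; x; z] by move=> t; rewrite !inE orbCA.
apply: (eq_window E); split=> [w wT|v w vT wT].
  by case: (W1 w wT) => -[a b]; [right; split; apply/aboveN|left; split; apply/belowN].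
rewrite !ltrN2 => l; case: (ltgtP (h w) (h v)) => // [/(W2 _ _ vT wT) l'|/hI E'].
  by have := lt_trans l l'; rewrite ltxx.
by rewrite E' ltxx in l.
Qed.

(** Four balls outside the window leave three on one side or two on each. *)
Lemma rotation_outside h g x y z : is_height h -> is_height g ->
  sorted3 h x y z -> sorted3 g z x y -> window h g [:: x; y; z] ->
  forall w, uniq w -> size w = 4 -> {in w, forall i, i \notin [:: x; y; z]} -> False.
Proof.
move=> Kh Kg sh sg W w uw sw Hw.
have [T [r [q C]]] := rotation_crossing Kh Kg sh sg.
have [[hI _] [gI _]] := conj (is_height_admissible Kh) (is_height_admissible Kg).
set T3 := [:: x; y; z] in W Hw.
have xT : x \in T3 by rewrite !inE eqxx.
have yT : y \in T3 by rewrite !inE eqxx orbT.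
have zT : z \in T3 by rewrite !inE eqxx !orbT.
have [W1 W2] := W.
pose A := [seq i <- w | h i < h x]; pose B := [seq i <- w | ~~ (h i < h x)].
have hA i : i \in A -> [/\ i \notin T3, below h T3 i & below g T3 i].
  rewrite mem_filter => /andP[l iw]; case: (W1 i (Hw i iw)) => -[a b]; first by split=> //; exact: Hw.
  by have := lt_trans l (a _ xT); rewrite ltxx.
have hB i : i \in B -> [/\ i \notin T3, above h T3 i & above g T3 i].
  rewrite mem_filter => /andP[l iw]; case: (W1 i (Hw i iw)) => -[a b]; last by split=> //; exact: Hw.
  by rewrite a in l.
have uA : uniq A by exact: filter_uniq.
have uB : uniq B by exact: filter_uniq.
have szAB : (size A + size B = 4)%N by rewrite !size_filter count_predC.
have [A3|A3] := leqP 3 (size A).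
  apply: (no_three_below Kh Kg sh sg W (w := take 3 A)); rewrite ?take_uniq ?size_takel //.
  by move=> i /mem_take /hA[].
have [B3|B3] := leqP 3 (size B).
  have sg' : sorted3 (fun i => - g i) y x z by case: sg => a b; split; rewrite ltrN2.
  have sh' : sorted3 (fun i => - h i) z y x by case: sh => a b; split; rewrite ltrN2.
  apply: (no_three_below (is_heightN Kg) (is_heightN Kh) sg' sh' (windowN hI gI W) (w := take 3 B));
    rewrite ?take_uniq ?size_takel //.
  move=> i /mem_take /hB[iT _ iA]; split; first by move: iT; rewrite !inE orbCA.
  by apply/belowN => t; rewrite !inE orbCA => tT; apply: iA; rewrite !inE.
have [{}A3 {}B3] : size A = 2 /\ size B = 2 by lia.
have pair L : uniq L -> size L = 2 -> exists i j, [/\ i \in L, j \in L & h i < h j].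
  case: L => [|i [|j [|//]]] //=; rewrite inE andbT => ij _.
  case: (ltgtP (h i) (h j)) => [l|l|/hI E].
  - by exists i, j; rewrite !inE !eqxx orbT.
  - by exists j, i; rewrite !inE !eqxx orbT.
  - by rewrite E eqxx in ij.
have [a1 [a2 [/hA[a1T _ _] /hA[a2T a2h a2g] l1]]] := pair A uA A3.
have [b1 [b2 [/hB[b1T b1h b1g] /hB[b2T _ _] l2]]] := pair B uB B3.
exact: (no_two_two C sh sg l1 (a2h _ xT) (b1h _ zT) l2 (W2 _ _ a1T a2T l1)
  (a2g _ zT) (b1g _ yT) (W2 _ _ b1T b2T l2)).
Qed.

End TwoLines.

Local Open Scope classical_set_scope.

(** * Unit balls, line transversals and permutations *)

Section Balls.
Variables (R : realType) (d : nat).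
Implicit Types (x y p v : 'rV[R]_d).

Lemma unit_ballP p x : unit_ball p x <-> dot (x - p) (x - p) <= 1.
Proof.
rewrite /unit_ball /= /enorm -[X in _ <= X]sqrtr1 ler_sqrt //.
Qed.

Lemma continuous_dist p : continuous (fun x => dot (x - p) (x - p)).
Proof.
have coord i : continuous (fun x : 'rV[R]_d => (x - p) 0 i).
  rewrite (_ : (fun _ => _) = (fun x : 'rV[R]_d => x 0 i) \- (fun=> p 0 i)).
    by move=> x; apply: continuousB; [exact: coord_continuous|exact: cst_continuous].
  by apply/funext => x; rewrite !mxE.
have H (s : seq 'I_d) : continuous (fun x : 'rV[R]_d => \sum_(i <- s) (x - p) 0 i * (x - p) 0 i).
  elim: s => [|i s IH].
    rewrite (_ : (fun _ => _) = (fun=> 0)); first exact: cst_continuous.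
    by apply/funext => x; rewrite big_nil.
  rewrite (_ : (fun _ => _) = (fun x => (x - p) 0 i * (x - p) 0 i) \+
    (fun x => \sum_(i <- s) (x - p) 0 i * (x - p) 0 i)); last first.
    by apply/funext => x; rewrite big_cons.
  move=> x; apply: continuousD; last exact: IH.
  by apply: continuousM; exact: coord.
exact: H.
Qed.

Lemma interior_unit_ball p x : dot (x - p) (x - p) < 1 -> (unit_ball p)° x.
Proof.
move=> l; rewrite /interior /=.
have : \forall y \near x, dot (y - p) (y - p) < 1.
  exact: (cvgr_lt _ (@continuous_dist p x)).
by apply: filterS => y /ltW /unit_ballP.
Qed.

Lemma interior_unit_ball_lt p x : (unit_ball p)° x -> dot (x - p) (x - p) < 1.
Proof.
move=> ix; have /unit_ballP := interior_subset ix.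
rewrite le_eqVlt => /orP[/eqP E|//]; exfalso.
(* A point of the sphere is pushed outwards: [x + t *: (x - p)] tends to [x] but has distance 1 + t
   from [p]. *)
have cv : (x + t *: (x - p)) @[t --> (0 : R)^'+] --> x.
  apply: cvg_at_right_filter.
  have : (x + t *: (x - p)) @[t --> (0 : R)] --> x + 0 *: (x - p).
    by apply: cvgD; [exact: cvg_cst|apply: cvgZr_tmp; exact: cvg_id].
  by rewrite scale0r addr0.
have near1 : \forall t \near (0 : R)^'+, unit_ball p (x + t *: (x - p)) := cv _ ix.
have near2 : \forall t \near (0 : R)^'+, 0 < t := nbhs_right_gt 0.
have [t [/unit_ballP t1 t0]] := filter_ex (filterI near1 near2).
move: t1; have -> : x + t *: (x - p) - p = (1 + t) *: (x - p).
  by rewrite scalerDl scale1r addrAC.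
by rewrite dotZl dotZr E; nra.
Qed.

End Balls.

Section Bridge.
Variables (R : realType) (d n : nat) (c : 'I_n -> 'rV[R]_d).
Implicit Types (p v : 'rV[R]_d).

Let F i := unit_ball (c i).

(** The midpoint of two centers at distance less than 2 is interior to both balls. *)
Lemma non_overlapping_dist : non_overlapping F -> forall i j, i != j -> 4 <= dist2 c i j.
Proof.
move=> hF i j ij; rewrite leNgt; apply/negP => l.
have mid (a b : 'rV[R]_d) : dot (2^-1 *: (a + b) - a) (2^-1 *: (a + b) - a) = dot (a - b) (a - b) / 4.
  have -> : 2^-1 *: (a + b) - a = (- 2^-1) *: (a - b) by apply/rowP => k; rewrite !mxE; field.
  by rewrite dotZl dotZr; field.
suff : (F i)° `&` (F j)° = set0 -> False by apply; exact: hF.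
pose m : 'rV[R]_d := 2^-1 *: (c i + c j).
move/seteqP => -[/(_ m)] H _; apply: H; split; apply: interior_unit_ball; rewrite /m.
  by rewrite mid -/(dist2 c i j); lra.
by rewrite (addrC (c i)) mid dot_subC -/(dist2 c i j); lra.
Qed.

Hypothesis sep : forall i j, i != j -> 4 <= dist2 c i j.

Section Line.
Variables (p v : 'rV[R]_d).
Hypothesis tr : line_transversal F p v.

Let N := Num.sqrt (dot v v).
Let u := N^-1 *: v.

Lemma norm_gt0 : 0 < N.
Proof.
have [v0 _ _] := tr; rewrite sqrtr_gt0 lt_neqAle dot_ge0 andbT eq_sym.
by apply: contra v0 => /eqP /dot_eq0 ->.
Qed.

Lemma unit_dir : dot u u = 1.
Proof.
have n0 := norm_gt0; have NN : N ^+ 2 = dot v v by rewrite sqr_sqrtr ?dot_ge0.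
rewrite /u dotZl dotZr mulrA -expr2 -NN exprVn mulVf // expf_neq0 //.
by rewrite gt_eqF.
Qed.

Lemma scale_dir t : t *: v = (t * N) *: u.
Proof. by rewrite /u scalerA mulfK // gt_eqF // norm_gt0. Qed.

Lemma dist_line i s : dot (p + s *: u - c i) (p + s *: u - c i) =
  dot (perp u (c i - p)) (perp u (c i - p)) + (s - dot u (c i - p)) ^+ 2.
Proof.
rewrite dot_perp ?unit_dir //.
have -> : p + s *: u - c i = s *: u - (c i - p) by apply/rowP => k; rewrite !mxE; ring.
by have := unit_dir; move: u (c i - p) => w x w1; rewrite !dotE w1 (dotC x w); ring.
Qed.

Lemma perp_le1 i : dot (perp u (c i - p)) (perp u (c i - p)) <= 1.
Proof.
have [_ meet _] := tr; have [_ [[t _ <-] /unit_ballP]] := meet i.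
rewrite /= scale_dir dist_line => H.
have := sqr_ge0 (t * N - dot u (c i - p)); lra.
Qed.

(** The point of the line closest to [c i]; the division by [N] passes from the unit direction [u]
    to [v]. *)
Let foot i := p + (dot u (c i - p) / N) *: v.

Lemma foot_dist i : dot (foot i - c i) (foot i - c i) = dot (perp u (c i - p)) (perp u (c i - p)).
Proof. by rewrite /foot scale_dir divfK ?gt_eqF ?norm_gt0 // dist_line subrr expr0n addr0. Qed.

Lemma foot_tangent i q : line p v q -> dot (q - c i) (q - c i) <= 1 ->
  dot (perp u (c i - p)) (perp u (c i - p)) = 1 -> tangent_at (line p v) (F i) q.
Proof.
move=> lq q1 m1; split; [exact: lq|exact/unit_ballP|].
apply/seteqP; split=> // y [[t _ <-] /interior_unit_ball_lt].
rewrite /= scale_dir dist_line m1 => H.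
have := sqr_ge0 (t * N - dot u (c i - p)); lra.
Qed.

(** Centers of equal height have the same foot, and projections of norm at most one at distance at
    least 2. Both norms are then one, and the line touches both balls at the common foot. *)
Lemma height_inj : injective (height c u).
Proof.
move=> i j E; apply/eqP; apply: contrapT => /negP ij.
have [_ _ nt] := tr; apply: (nt i j (foot i) ij).
have E' : dot u (c i - p) = dot u (c j - p).
  by move: E; rewrite /height !dotDr => ->.
have fE : foot i = foot j by rewrite /foot E'.
have := sep ij; rewrite /dist2.
have D : dot (c i - c j) (c i - c j) = dot (perp u (c i - p) - perp u (c j - p)) (perp u (c i - p) - perp u (c j - p)).
  by rewrite perpB dot_perp ?unit_dir // -(heightB c u) E subrr expr0n subr0.
have mi := perp_le1 i; have mj := perp_le1 j.
rewrite D => H.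
have S := dot_sum_diff (perp u (c i - p)) (perp u (c j - p)).
have S0 := dot_ge0 (perp u (c i - p) + perp u (c j - p)).
have lf : line p v (foot i) by exists (dot u (c i - p) / N).
split; apply: foot_tangent => //.
- by rewrite foot_dist.
- lra.
- by rewrite fE foot_dist.
- lra.
Qed.

Lemma line_transversal_unit : transversal c u p.
Proof. by split; [exact: unit_dir|exact: height_inj|exact: perp_le1]. Qed.

(** It suffices to compare the two feet; [height_inj] makes the inequality strict. *)
Lemma meets_before_height i j : i != j -> meets_before p v (F i) (F j) ->
  height c u i < height c u j.
Proof.
move=> ij mb.
have fi k : F k (foot k) by apply/unit_ballP; rewrite foot_dist; exact: perp_le1.
have := mb _ _ (fi i) (fi j).
rewrite ler_pM2r ?invr_gt0 ?norm_gt0 // !dotDr lerD2r => l.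
rewrite lt_neqAle l andbT; apply: contra ij => /eqP E.
by apply/eqP; exact: height_inj E.
Qed.

End Line.

Definition sorted_by (h : 'I_n -> R) (s : 'S_n) := forall i j : 'I_n, (i < j)%N -> h (s i) < h (s j).

Lemma induced_height s : induced_order F s -> exists2 h, is_height c h & sorted_by h s.
Proof.
move=> [p [v [tr mb]]]; exists (height c ((Num.sqrt (dot v v))^-1 *: v)).
  exists ((Num.sqrt (dot v v))^-1 *: v), p; split=> //; exact: line_transversal_unit tr.
move=> i j ij; apply: (meets_before_height tr); last exact: mb.
by rewrite (inj_eq perm_inj); apply: contraTneq ij => ->; rewrite ltnn.
Qed.

End Bridge.

(** * Permutations and the orders given by heights *)

Section Perms.
Variables (R : realType) (n : nat).
Implicit Types (h g : 'I_n -> R) (s t : 'S_n).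

Lemma sorted_by_inj h s t : sorted_by h s -> sorted_by h t -> s = t.
Proof.
move=> hs ht.
have tr : transitive (fun i j : 'I_n => h i < h j) by move=> ? ? ?; exact: lt_trans.
have ir : irreflexive (fun i j : 'I_n => h i < h j) by move=> ?; rewrite ltxx.
have so (r : 'S_n) : sorted_by h r -> sorted (fun i j => h i < h j) [seq r i | i <- enum 'I_n].
  move=> hr; rewrite sorted_map.
  have : sorted (relpre val ltn) (enum 'I_n) by rewrite -sorted_map val_enum_ord iota_ltn_sorted.
  by apply: sub_sorted => i j; exact: hr.
have me (r : 'S_n) k : k \in [seq r i | i <- enum 'I_n].
  by apply/mapP; exists ((r^-1)%g k); rewrite ?mem_enum ?permKV.
have E := irr_sorted_eq tr ir (so _ hs) (so _ ht) (fun k => etrans (me s k) (esym (me t k))).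
by apply/permP => i; move/eq_in_map: E; apply; rewrite mem_enum.
Qed.

Lemma reverse_orderK s : reverse_order (reverse_order s) = s.
Proof. by apply/permP => i; rewrite !permM !permE rev_ordK. Qed.

(** With equal middles, [h] and [g] agree on all pairs of a triple or on none. Agreement on one pair
    of distinct elements, expressed by [S], therefore spreads to all pairs. *)
Lemma not_differ (I : eqType) (h g : I -> R) : injective h -> injective g -> ~ differ h g ->
  (forall p q, (h p < h q) = (g p < g q)) \/ (forall p q, (h p < h q) = (g q < g p)).
Proof.
move=> hI gI nd.
pose S p q := (h p < h q) = (g p < g q).
have anti p q : p != q -> (h q < h p) = ~~ (h p < h q) /\ (g q < g p) = ~~ (g p < g q).
  rewrite -leNgt -leNgt => pq; split; rewrite lt_neqAle.
    by rewrite (inj_eq hI) eq_sym pq.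
  by rewrite (inj_eq gI) eq_sym pq.
have Sxx p : S p p by rewrite /S !ltxx.
have Ssym p q : S p q -> S q p.
  have [->//|pq] := eqVneq p q; have [E1 E2] := anti p q pq.
  by rewrite /S E1 E2 => ->.
have Str x y z : x != y -> S x y -> S x z.
  move=> xy Sxy; have [->//|xz] := eqVneq x z; have [<-//|yz] := eqVneq y z.
  have u : uniq [:: x; y; z] by rewrite /= !inE negb_or xy xz yz.
  have m : mid h x y z = mid g x y z.
    by apply: contrapT => /eqP ne; apply: nd; exists x, y, z.
  have [xT yT zT] : [/\ x \in [:: x; y; z], y \in [:: x; y; z] & z \in [:: x; y; z]].
    by rewrite !inE !eqxx !orbT.
  case: (eq_mid_orders hI gI u m) => E; first exact: E.
  have := E x y xT yT; rewrite Sxy; have [_ ->] := anti x y xy.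
  by case: (g x < g y).
have [[p [q [pq Spq]]]|N] := pselect (exists p q, p != q /\ S p q).
  left=> x y; have Sp r : S p r by exact: (Str p q r).
  have [<-|px] := eqVneq p x; first exact: Sp.
  by apply: (Str x p y); rewrite 1?eq_sym //; exact: Ssym.
right=> x y; have [<-|xy] := eqVneq x y; first by rewrite !ltxx.
have [_ ->] := anti x y xy.
have : ~ S x y by move=> Sxy; apply: N; exists x, y.
by rewrite /S; case: (h x < h y); case: (g x < g y).
Qed.

Lemma differ_orders h g s t : injective h -> injective g -> sorted_by h s -> sorted_by g t ->
  [set s; reverse_order s]%SET != [set t; reverse_order t]%SET -> differ h g.
Proof.
move=> hI gI hs gt ne; apply: contrapT => nd; case/eqP: ne.
case: (not_differ hI gI nd) => E.
  have -> // : s = t.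
  by apply: (sorted_by_inj (h := g)) => // i j ij; rewrite -E; exact: hs.
have -> : t = reverse_order s.
  apply: (sorted_by_inj (h := g)) => // i j ij.
  rewrite -E; rewrite /reverse_order !permM !permE; apply: hs => /=.
  by have := ltn_ord j; lia.
by rewrite reverse_orderK finset.setUC.
Qed.

End Perms.

Lemma outside_exists n (T : seq 'I_n) m : (size T + m <= n)%N ->
  exists w : seq 'I_n, [/\ uniq w, size w = m & {in w, forall i, i \notin T}].
Proof.
move=> H; pose L := [seq i <- enum 'I_n | i \notin T].
have sL : (m <= size L)%N.
  have := count_predC (mem T) (enum 'I_n); rewrite size_enum_ord => E.
  have : (count (mem T) (enum 'I_n) <= size T)%N.
    rewrite -size_filter; apply: uniq_leq_size; first by rewrite filter_uniq ?enum_uniq.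
    by move=> i; rewrite mem_filter => /andP[].
  have -> : size L = count (predC (mem T)) (enum 'I_n) by rewrite size_filter.
  by lia.
exists (take m L); split; first exact/take_uniq/filter_uniq/enum_uniq.
  by rewrite size_takel.
by move=> i /mem_take; rewrite mem_filter => /andP[].
Qed.

(** * Counting the geometric permutations *)

Section Counting.
Variables (R : realType) (d n : nat) (c : 'I_n -> 'rV[R]_d).
Hypothesis sep : forall i j, i != j -> 4 <= dist2 c i j.

Let GP := geometric_permutations (fun i => unit_ball (c i)).

Lemma geometric_permutation_height X : X \in GP -> exists h s,
  [/\ is_height c h, sorted_by h s & X = [set s; reverse_order s]%SET].
Proof.
case/imsetP=> s; rewrite inE => /asboolP /(induced_height sep) [h hh hs] ->.
by exists h, s.
Qed.

Lemma differ_of_neq X Y h s g t : is_height c h -> sorted_by h s ->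
  X = [set s; reverse_order s]%SET -> is_height c g -> sorted_by g t ->
  Y = [set t; reverse_order t]%SET -> X != Y -> differ h g.
Proof.
move=> /(is_height_admissible sep) [hI _] hs -> /(is_height_admissible sep) [gI _] gt ->.
exact: differ_orders.
Qed.

Lemma card_geometric_permutations_le3 : (#|GP| <= 3)%N.
Proof.
rewrite leqNgt; apply/negP => /card_geqP[s [u ss sub]].
move: s ss u sub => [|X1 [|X2 [|X3 [|X4 [|//]]]]] // _ u sub.
have mem X : X \in [:: X1; X2; X3; X4] -> X \in GP by move/sub.
have [|h1 [s1 [K1 S1 E1]]] := geometric_permutation_height (X := X1); first by apply: mem; rewrite !inE eqxx.
have [|h2 [s2 [K2 S2 E2]]] := geometric_permutation_height (X := X2); first by apply: mem; rewrite !inE eqxx orbT.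
have [|h3 [s3 [K3 S3 E3]]] := geometric_permutation_height (X := X3); first by apply: mem; rewrite !inE eqxx !orbT.
have [|h4 [s4 [K4 S4 E4]]] := geometric_permutation_height (X := X4); first by apply: mem; rewrite !inE eqxx !orbT.
move: u; rewrite /= !inE !negb_or => /and4P[/and3P[n12 n13 n14] /andP[n23 n24] n34 _].
have A := is_height_admissible sep.
apply: (no_four_orders (dist2C c) (A _ K1) (A _ K2) (A _ K3) (A _ K4)).
- exact: (differ_of_neq K1 S1 E1 K2 S2 E2).
- exact: (differ_of_neq K1 S1 E1 K3 S3 E3).
- exact: (differ_of_neq K1 S1 E1 K4 S4 E4).
- exact: (differ_of_neq K2 S2 E2 K3 S3 E3).
- exact: (differ_of_neq K2 S2 E2 K4 S4 E4).
- exact: (differ_of_neq K3 S3 E3 K4 S4 E4).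
Qed.

Lemma card_geometric_permutations_le2 : (7 <= n)%N -> (#|GP| <= 2)%N.
Proof.
move=> n7; rewrite leqNgt; apply/negP => /card_geqP[s [u ss sub]].
move: s ss u sub => [|X1 [|X2 [|X3 [|//]]]] // _ u sub.
have mem X : X \in [:: X1; X2; X3] -> X \in GP by move/sub.
have [|h1 [s1 [K1 S1 E1]]] := geometric_permutation_height (X := X1); first by apply: mem; rewrite !inE eqxx.
have [|h2 [s2 [K2 S2 E2]]] := geometric_permutation_height (X := X2); first by apply: mem; rewrite !inE eqxx orbT.
have [|h3 [s3 [K3 S3 E3]]] := geometric_permutation_height (X := X3); first by apply: mem; rewrite !inE eqxx !orbT.
move: u; rewrite /= !inE !negb_or => /and3P[/andP[n12 n13] n23 _].
have d12 := differ_of_neq K1 S1 E1 K2 S2 E2 n12.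
have d13 := differ_of_neq K1 S1 E1 K3 S3 E3 n13.
have d23 := differ_of_neq K2 S2 E2 K3 S3 E3 n23.
have big (T : seq 'I_n) : size T = 3 -> exists a, a \notin T.
  move=> sT; have [|w [_ sw H]] := @outside_exists _ T 1; first by rewrite sT; lia.
  case: w sw H => [//|a w] _ H.
  by exists a; apply: H; rewrite inE eqxx.
have [h [g [x [y [z [Kh Kg sh sg W]]]]]] := rotation_exists (dist2C c)
  (fun h => is_height_admissible sep (h := h)) (fun h => is_heightN (h := h)) big K1 K2 K3 d12 d13 d23.
(* Seven balls leave four outside the window. *)
have [|w [uw sw Hw]] := @outside_exists _ [:: x; y; z] 4; first by rewrite /=; lia.
exact: (rotation_outside sep Kh Kg sh sg W uw sw Hw).
Qed.

End Counting.

Local Close Scope ring_scope.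
Local Close Scope classical_set_scope.

Theorem theorem1 (R : realType) (d n : nat) (c : 'I_n -> 'rV[R]_d)
    (hF : non_overlapping (fun i => unit_ball (c i))) :
  (n <= 6 -> #|geometric_permutations (fun i => unit_ball (c i))| <= 3) /\
  (7 <= n -> #|geometric_permutations (fun i => unit_ball (c i))| <= 2).
Proof.
have sep := non_overlapping_dist hF.
split=> [_|]; first exact: card_geometric_permutations_le3 sep.
exact: card_geometric_permutations_le2 sep.
Qed.
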